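(* Let $n\geq 1$ and let $T^\ast\mathbb{C}^n\cong\mathbb{C}^n\times\mathbb{C}^n$ with coordinates $(x,y)=(x_1,\dots,x_n,y_1,\dots,y_n)$ carry the canonical symplectic form $\omega=\sum_{k=1}^n dx_k\wedge dy_k$. Then $(T^\ast\mathbb{C}^n,\omega)$ has the Hamiltonian holomorphic density property and the symplectic holomorphic density property. A dense Lie subalgebra (of the Lie algebra of Hamiltonian, equivalently symplectic, holomorphic vector fields) is generated by the complete vector fields \[ x_k^p\frac{\partial}{\partial y_k},\qquad y_k^q\frac{\partial}{\partial x_k},\qquad x_j\frac{\partial}{\partial y_k}+x_k\frac{\partial}{\partial y_j},\qquad y_j\frac{\partial}{\partial x_k}+y_k\frac{\partial}{\partial x_j}, \] where $j,k\in\{1,\dots,n\}$ with $j \neq k$ in the last two families, and $p,q\in\mathbb{N}_0$; these have Hamiltonian functions $-\frac{1}{p+1}x_k^{p+1}$, $\frac{1}{q+1}y_k^{q+1}$, $-x_jx_k$ and $y_jy_k$, respectively.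
   Context: Let $M$ be a complex manifold with a symplectic holomorphic form $\omega$. A holomorphic vector field $V$ on $M$ is symplectic if $\mathcal{L}_V\omega=0$, and Hamiltonian if there is a holomorphic function $H\colon M\to\mathbb{C}$ (its Hamiltonian function) with $i_V\omega=dH$. A holomorphic vector field is complete if its flow exists for all complex times. $(M,\omega)$ has the symplectic (respectively Hamiltonian) holomorphic density property if the Lie algebra generated by the complete symplectic (respectively Hamiltonian) holomorphic vector fields on $M$ is dense, in the topology of locally uniform convergence, in the Lie algebra of all symplectic (respectively Hamiltonian) holomorphic vector fields on $M$. *)

(* Defs.v *)
From HB Require Import structures.
From mathcomp Require Import all_boot all_order all_algebra.
From mathcomp Require Import complex.
From mathcomp Require Import all_classical all_reals all_analysis.

Set Implicit Arguments.
Unset Strict Implicit.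
Unset Printing Implicit Defensive.

Import Order.TTheory GRing.Theory Num.Theory.
Import numFieldNormedType.Exports.

Local Open Scope classical_set_scope.
Local Open Scope ring_scope.

(** The field of complex numbers over [R], with its normed space structure
    over itself; it is used both as scalars and as complex time. *)
Notation Cplx R := (R[i]^o).

Section HolomorphicVectorFields.
Context {R : realType} {X : normedModType R[i]}.

(** Since the scalars are complex, [differentiable] is complex (Fréchet)
    differentiability. *)
Definition holomorphic (Y : normedModType R[i]) (f : X -> Y) : Prop :=
  forall z, differentiable f z.

Definition complete_field (V : X -> X) : Prop :=
  exists phi : Cplx R -> X -> X, forall z : X,
    phi 0 z = z /\
    forall t : Cplx R, is_derive t (1 : Cplx R) (fun s => phi s z) (V (phi t z)).

Definition lie_bracket (V W : X -> X) : X -> X :=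
  fun z => 'd W z (V z) - 'd V z (W z).

Definition lie_subalgebra (L : set (X -> X)) : Prop :=
  [/\ L (fun=> 0),
      forall (a : R[i]) V W, L V -> L W -> L (fun z => a *: V z + W z) &
      forall V W, L V -> L W -> L (lie_bracket V W)].

Definition lie_generated (G : set (X -> X)) : set (X -> X) :=
  smallest lie_subalgebra G.

(** On the locally compact spaces considered here, locally uniform convergence
    is uniform convergence on compact sets. *)
Definition dense_in (S L : set (X -> X)) : Prop :=
  S `<=` L /\ L `<=` closure (S : set {family compact, X -> X}).

(** A 2-form maps a point and two tangent vectors to a scalar. *)
Definition form2 := X -> X -> X -> Cplx R.

(** (L_V w)(u, v) = V(w(u, v)) - w([V, u], v) - w(u, [V, v]), with the tangent
    vectors u and v extended to constant vector fields. *)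
Definition lie_derivative (V : X -> X) (w : form2) : form2 :=
  fun z u v =>
    'd (fun z' => w z' u v) z (V z)
    - w z (lie_bracket V (fun=> u) z) v
    - w z u (lie_bracket V (fun=> v) z).

Definition symplectic_fields (w : form2) : set (X -> X) :=
  [set V | holomorphic V /\ forall z u v, lie_derivative V w z u v = 0].

Definition hamiltonian_function (w : form2) (V : X -> X) (H : X -> Cplx R)
    : Prop :=
  holomorphic H /\ forall z v, w z (V z) v = 'd H z v.

Definition hamiltonian_fields (w : form2) : set (X -> X) :=
  [set V | holomorphic V /\ exists H, hamiltonian_function w V H].

Definition symplectic_density_property (w : form2) : Prop :=
  dense_in (lie_generated (symplectic_fields w `&` complete_field))
    (symplectic_fields w).

Definition hamiltonian_density_property (w : form2) : Prop :=
  dense_in (lie_generated (hamiltonian_fields w `&` complete_field))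
    (hamiltonian_fields w).

End HolomorphicVectorFields.

Arguments form2 {R} X.

Section CotangentSpace.
Context (R : realType) (n : nat).

Definition cotangent : normedModType R[i] :=
  ('rV[Cplx R]_n * 'rV[Cplx R]_n)%type.

Definition xc (k : 'I_n) (z : cotangent) : Cplx R := z.1 ord0 k.
Definition yc (k : 'I_n) (z : cotangent) : Cplx R := z.2 ord0 k.

Definition ddx (k : 'I_n) : cotangent := (delta_mx ord0 k, 0).
Definition ddy (k : 'I_n) : cotangent := (0, delta_mx ord0 k).

Definition canonical_symplectic_form : form2 cotangent :=
  fun _ u v => \sum_(k < n) (xc k u * yc k v - xc k v * yc k u).

Definition shear_y (k : 'I_n) (p : nat) : cotangent -> cotangent :=
  fun z => xc k z ^+ p *: ddy k.
Definition shear_x (k : 'I_n) (q : nat) : cotangent -> cotangent :=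
  fun z => yc k z ^+ q *: ddx k.
Definition mixed_y (j k : 'I_n) : cotangent -> cotangent :=
  fun z => xc j z *: ddy k + xc k z *: ddy j.
Definition mixed_x (j k : 'I_n) : cotangent -> cotangent :=
  fun z => yc j z *: ddx k + yc k z *: ddx j.

Definition generators : set (cotangent -> cotangent) :=
  [set V | [\/ exists k p, V = shear_y k p,
               exists k q, V = shear_x k q,
               exists j k, j != k /\ V = mixed_y j k |
               exists j k, j != k /\ V = mixed_x j k]].

End CotangentSpace.

Arguments canonical_symplectic_form R n : clear implicits.
Arguments generators R n : clear implicits.

(* Main.v *)
(** Polynomial Hamiltonians are generated: in terms of Poisson brackets,
    x_k^p and y_k^q give all x_k^p y_k^q; if M only involves the pairs k < i, the
    bracket of M y_0 with x_0 x_i is a multiple of M x_i, and bracketing M x_i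
    with x_i^p y_i^(q+1) gives M x_i^p y_i^q.  A Hamiltonian H is approximated
    by polynomials locally uniformly, and by the Cauchy estimates their
    Hamiltonian fields then approximate that of H.

    The complex analysis needed for this starts from mere differentiability.
    Integrals along segments are limits of dyadic trapezoid sums; Goursat's
    bisection argument, run for the 1-form b(V, dz) with symmetric b(V', .),
    yields primitives both of entire functions (b the product of C) and of
    symplectic fields (b the symplectic form, which is the Poincare lemma).
    Entire functions of one variable are limits of their interpolation
    polynomials at the roots of unity of large circles; interpolating in one
    coordinate after the other gives polynomial density in several variables,
    and bounds on the interpolation polynomials give the Cauchy estimates. *)
Require Import Defs.
From HB Require Import structures.
From mathcomp Require Import all_boot all_order all_algebra.
From mathcomp Require Import complex.
From mathcomp Require Import all_classical all_reals all_analysis.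
From mathcomp Require Import ring lra.

Set Implicit Arguments.
Unset Strict Implicit.
Unset Printing Implicit Defensive.

Import Order.TTheory GRing.Theory Num.Theory.
Import numFieldNormedType.Exports.

Local Open Scope classical_set_scope.
Local Open Scope ring_scope.

(** The obstacle is that [holomorphic] only asks for a Fréchet derivative at each point: nothing is
    known at the outset about continuity of derivatives. Discretized arguments, however, need
    [F v - F u - f u * (v - u)] to be small compared with [v - u], uniformly on compact sets. For a
    primitive [F] of [f] this follows from the continuity of [f] alone, and Goursat's argument
    supplies such primitives. Hence interpolation is first controlled on primitives and then
    transferred to the function itself through difference quotients of a fixed step. Regularity in
    several variables, in particular the symmetry of second derivatives, uses no integral formula:
    it is algebra for polynomials and passes to the limit because the Cauchy estimates bound first
    and second order differences uniformly. *)

(** * Real-valued norms over the complex scalars *)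

Section RealNorm.
Context {R : realType}.
Local Notation C := (Cplx R).

(* Norms over [R[i]] take values in the partially ordered field [R[i]]; [nm] is
   the same norm with values in [R]. *)
Definition nm {X : normedModType R[i]} (z : X) : R := complex.Re `|z|.

Definition rc (x : R) : C := real_complex R x.

Lemma posc_realP (e : R[i]) : 0 < e -> exists2 r : R, 0 < r & e = rc r.
Proof.
move=> e0; have er : e = rc (complex.Re e).
  by rewrite /rc RRe_real// ger0_real// ltW.
by exists (complex.Re e) => //; move: e0; rewrite {1}er /rc -(ltcR 0 (complex.Re e)) rmorph0.
Qed.

Lemma rc_gt0 (r : R) : 0 < r -> 0 < (rc r : R[i]).
Proof. by move=> r0; rewrite /rc -[0]/(rc 0) ltcR. Qed.

Section Norm.
Context {X : normedModType R[i]}.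
Implicit Types z w : X.

Lemma nmE z : `|z| = rc (nm z).
Proof. by rewrite /rc RRe_real ?normr_real. Qed.

Lemma nm_le z (r : R) : (`|z| <= rc r) = (nm z <= r).
Proof. by rewrite nmE /rc lecR. Qed.

Lemma nm_lt z (r : R) : (`|z| < rc r) = (nm z < r).
Proof. by rewrite nmE /rc ltcR. Qed.

Lemma nm_ge0 z : 0 <= nm z.
Proof. by rewrite -ler0c -[X in 0 <= X]nmE. Qed.

Lemma nm0 : nm (0 : X) = 0.
Proof. by rewrite /nm normr0. Qed.

Lemma nm0_eq0 z : nm z = 0 -> z = 0.
Proof. by move=> h; apply/eqP; rewrite -normr_eq0 nmE h. Qed.

Lemma nm_gt0 z : (0 < nm z) = (z != 0).
Proof.
rewrite lt_neqAle nm_ge0 andbT eq_sym; congr (~~ _); apply/eqP/eqP; last first.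
  by move=> ->; exact: nm0.
exact: nm0_eq0.
Qed.

Lemma nmD z w : nm (z + w) <= nm z + nm w.
Proof.
rewrite -nm_le (_ : rc _ = `|z| + `|w|) ?ler_normD//.
by rewrite !nmE /rc rmorphD.
Qed.

Lemma nmN z : nm (- z) = nm z.
Proof. by rewrite /nm normrN. Qed.

Lemma nmB z w : nm (z - w) <= nm z + nm w.
Proof. by rewrite -(nmN w) nmD. Qed.

Lemma nm_distC z w : nm (z - w) = nm (w - z).
Proof. by rewrite /nm distrC. Qed.

Lemma nm_sub_trans w z u : nm (z - u) <= nm (z - w) + nm (w - u).
Proof. by rewrite (le_trans _ (nmD _ _))// addrA subrK. Qed.

Lemma nmZ (a : C) z : nm (a *: z) = nm a * nm z.
Proof. by rewrite {1}/nm normrZ !nmE /rc -rmorphM. Qed.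

Lemma nm_sum (I : Type) (s : seq I) (P : pred I) (F : I -> X) :
  nm (\sum_(i <- s | P i) F i) <= \sum_(i <- s | P i) nm (F i).
Proof.
elim/big_ind2 : _ => [|x x' y y' hx hy|//]; first by rewrite nm0.
by rewrite (le_trans (nmD _ _)) ?lerD.
Qed.

Lemma nbhs_nmP z (P : set X) :
  nbhs z P <-> exists2 d : R, 0 < d & forall w, nm (w - z) < d -> P w.
Proof.
rewrite -filter_from_ballE; split=> [[e /= /posc_realP [r r0 ->] he]|[d d0 hd]].
  by exists r => // w hw; apply: he; rewrite -ball_normE /= distrC nm_lt.
exists (rc d); first exact: rc_gt0.
by move=> w; rewrite -ball_normE /= distrC nm_lt => /hd.
Qed.

End Norm.

Lemma nmM (a b : C) : nm (a * b) = nm a * nm b.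
Proof. exact: nmZ. Qed.

Lemma nm1 : nm (1 : C) = 1.
Proof. by rewrite /nm normr1. Qed.

Lemma nmX (a : C) k : nm (a ^+ k) = nm a ^+ k.
Proof. by elim: k => [|k ih]; rewrite ?expr0 ?nm1// !exprS nmM ih. Qed.

Lemma nmV (a : C) : nm (a^-1) = (nm a)^-1.
Proof.
have [->|a0] := eqVneq a 0; first by rewrite invr0 nm0 invr0.
have h : nm a * nm a^-1 = 1 by rewrite -nmM mulfV// nm1.
have n0 : nm a != 0 by rewrite gt_eqF// nm_gt0.
by apply: (mulfI n0); rewrite h mulfV.
Qed.

Lemma nm_rc (x : R) : nm (rc x) = `|x|.
Proof. by rewrite /nm normc_def /= expr0n addr0 sqrtr_sqr. Qed.

Lemma rc0 : rc 0 = 0. Proof. by rewrite /rc rmorph0. Qed.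
Lemma rc1 : rc 1 = 1. Proof. by rewrite /rc rmorph1. Qed.
Lemma rcD x y : rc (x + y) = rc x + rc y. Proof. by rewrite /rc rmorphD. Qed.
Lemma rcB x y : rc (x - y) = rc x - rc y. Proof. by rewrite /rc rmorphB. Qed.
Lemma rcM x y : rc (x * y) = rc x * rc y. Proof. by rewrite /rc rmorphM. Qed.
Lemma rcV x : rc x^-1 = (rc x)^-1. Proof. by rewrite /rc fmorphV. Qed.
Lemma rc_nat k : rc k%:R = k%:R. Proof. by rewrite /rc rmorph_nat. Qed.

Lemma nm_nat k : nm (k%:R : C) = k%:R.
Proof. by rewrite -rc_nat nm_rc normr_nat. Qed.

Lemma nm_Re_le (a : C) : `|complex.Re a| <= nm a.
Proof. by rewrite -lecR (le_trans (normc_ge_Re a))// nmE. Qed.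

Lemma nm_i : nm ('i%C : C) = 1.
Proof. by rewrite /nm normc_def /= expr0n add0r expr1n sqrtr1. Qed.

Lemma nm_Im_le (a : C) : `|complex.Im a| <= nm a.
Proof.
rewrite -(normrN (complex.Im a)) -ReiNIm (le_trans (nm_Re_le _))//.
by rewrite nmM nm_i mulr1.
Qed.

Lemma nm_Complex_le (x y : R) : nm (Complex x y : C) <= `|x| + `|y|.
Proof.
have -> : (Complex x y : C) = rc x + 'i%C * rc y by exact: (complexE (Complex x y)).
by rewrite (le_trans (nmD _ _))// nmM !nm_rc nm_i mul1r.
Qed.

End RealNorm.

(** * Limits, compactness and differentials in epsilon-delta form *)

Section Topology.
Context {R : realType}.
Local Notation C := (Cplx R).

Definition tends_to (u : nat -> C) (l : C) : Prop :=
  forall e : R, 0 < e -> exists N, forall n, (N <= n)%N -> nm (u n - l) <= e.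

Lemma real_cauchy_cvg (u : nat -> R) :
  (forall e : R, 0 < e -> exists N, forall m n, (N <= m)%N -> (N <= n)%N ->
    `|u m - u n| <= e) ->
  exists l, forall e : R, 0 < e -> exists N, forall n, (N <= n)%N -> `|u n - l| <= e.
Proof.
move=> hu.
have /R_complete /cvg_ex [l /cvgrPdist_le hl] : cauchy (u @ \oo).
  apply/cauchy_ballP => e e0.
  have e20 : 0 < e / 2 by rewrite divr_gt0.
  have [N hN] := hu _ e20.
  exists ([set x | exists2 n, (N <= n)%N & u n = x], [set x | exists2 n, (N <= n)%N & u n = x]).
    by split; exists N => //= n hn; exists n.
  move=> [x y] /= [[m hm <-] [n hn <-]].
  by rewrite /ball /= (le_lt_trans (hN _ _ hm hn))// ltr_pdivrMr// ltr_pMr// ltr1n.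
exists l => e e0; have [N _ hN] := hl e e0.
by exists N => n hn; rewrite distrC hN.
Qed.

Lemma complex_cauchy_cvg (u : nat -> C) :
  (forall e : R, 0 < e -> exists N, forall m n, (N <= m)%N -> (N <= n)%N ->
    nm (u m - u n) <= e) ->
  exists l, tends_to u l.
Proof.
move=> hu.
have [a ha] : exists l, forall e : R, 0 < e -> exists N, forall n, (N <= n)%N ->
    `|complex.Re (u n) - l| <= e.
  apply: real_cauchy_cvg => e e0; have [N hN] := hu e e0; exists N => m n hm hn.
  by rewrite (le_trans _ (hN _ _ hm hn))// -raddfB nm_Re_le.
have [b hb] : exists l, forall e : R, 0 < e -> exists N, forall n, (N <= n)%N ->
    `|complex.Im (u n) - l| <= e.
  apply: real_cauchy_cvg => e e0; have [N hN] := hu e e0; exists N => m n hm hn.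
  by rewrite (le_trans _ (hN _ _ hm hn))// -raddfB nm_Im_le.
exists (Complex a b) => e e0.
have e20 : 0 < e / 2 by rewrite divr_gt0.
have [N1 h1] := ha _ e20; have [N2 h2] := hb _ e20.
exists (maxn N1 N2) => n; rewrite geq_max => /andP[n1 n2].
have -> : u n - Complex a b =
    (Complex (complex.Re (u n) - a) (complex.Im (u n) - b) : C).
  by case: (u n).
by rewrite (le_trans (nm_Complex_le _ _))// [e]splitr lerD ?h1 ?h2.
Qed.

Lemma tends_to_le (u : nat -> C) l (c : C) (B : R) (N : nat) : tends_to u l ->
  (forall n, (N <= n)%N -> nm (u n - c) <= B) -> nm (l - c) <= B.
Proof.
move=> hu hB; apply/ler_addgt0Pr => e e0.
have [M hM] := hu e e0; pose n := maxn M N.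
rewrite (le_trans (nm_sub_trans (u n) _ _))// addrC lerD ?hB ?leq_maxr//.
by rewrite nm_distC hM// leq_maxl.
Qed.

Lemma tends_to_unique u l l' : tends_to u l -> tends_to u l' -> l = l'.
Proof.
move=> h h'; apply/eqP; rewrite -subr_eq0; apply/eqP/nm0_eq0/eqP.
rewrite eq_le nm_ge0 andbT; apply/ler_addgt0Pr => e e0; rewrite add0r.
have [N hN] := h' e e0.
by apply: (tends_to_le h hN).
Qed.

Lemma tends_toD u v l l' : tends_to u l -> tends_to v l' ->
  tends_to (fun n => u n + v n) (l + l').
Proof.
move=> hu hv e e0; have e20 : 0 < e / 2 by rewrite divr_gt0.
have [N1 h1] := hu _ e20; have [N2 h2] := hv _ e20.
exists (maxn N1 N2) => n; rewrite geq_max => /andP[n1 n2].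
have -> : u n + v n - (l + l') = (u n - l) + (v n - l') by rewrite opprD addrACA.
by rewrite (le_trans (nmD _ _))// [e]splitr lerD ?h1 ?h2.
Qed.

Lemma tends_toZ (a : C) u l : tends_to u l -> tends_to (fun n => a * u n) (a * l).
Proof.
move=> hu e e0; have d0 : 0 < nm a + 1 by rewrite ltr_wpDl ?nm_ge0.
have [N hN] := hu (e / (nm a + 1)) (divr_gt0 e0 d0).
exists N => n hn; rewrite -mulrBr nmM.
have /(ler_wpM2l (nm_ge0 a)) /le_trans -> // := hN n hn.
by rewrite mulrCA ler_piMr ?(ltW e0)// ler_pdivrMr// mul1r lerDl.
Qed.

Lemma tends_to_shift u l : tends_to u l -> tends_to (fun n => u n.+1) l.
Proof. by move=> h e e0; have [N hN] := h e e0; exists N => n hn; rewrite hN// leqW. Qed.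

Lemma tends_to_ext u v l : u =1 v -> tends_to u l -> tends_to v l.
Proof. by move=> /funext ->. Qed.

(** Only [z] is confined to [K]; [w] may leave it. Later uses compare a point of a segment or
    polydisc with all points of a small ball around it. *)
Lemma compact_unif_cont {X Y : normedModType R[i]} (K : set X) (f : X -> Y) :
  compact K -> continuous f -> forall e : R, 0 < e -> exists2 d : R, 0 < d &
    forall z w, K z -> nm (w - z) <= d -> nm (f w - f z) <= e.
Proof.
move=> /compact_near_coveringP cK cf e e0.
have /cK : forall x, K x -> \forall x' \near x & d \near (0 : R)^'+,
    forall w, nm (w - x') <= d -> nm (f w - f x') <= e.
  move=> x _.
  have /(_ _)/nbhs_nmP [] := cf x [set y | nm (y - f x) < e / 2].
    by apply/nbhs_nmP; exists (e / 2); rewrite ?divr_gt0.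
  move=> d d0 hd.
  exists ([set x' | nm (x' - x) < d / 2], [set t : R | t < d / 2]) => /=.
    split; first by apply/nbhs_nmP; exists (d / 2); rewrite ?divr_gt0.
    by apply: nbhs_right_lt; rewrite divr_gt0.
  move=> [x' t] /= [hx' ht] w hw.
  have h1 : nm (f w - f x) < e / 2.
    apply: hd; rewrite (le_lt_trans (nm_sub_trans x' _ _))// [d]splitr ltrD//.
    exact: le_lt_trans ht.
  have h2 : nm (f x' - f x) < e / 2.
    by apply: hd; rewrite (lt_trans hx')// ltr_pdivrMr// ltr_pMr// ltr1n.
  rewrite (le_trans (nm_sub_trans (f x) _ _))// [e]splitr lerD ?ltW//.
  by rewrite nm_distC.
move=> h.
have : \forall d \near (0:R)^'+, 0 < d /\ (K `<=` (fun x' => forall w, nm (w - x') <= d -> nm (f w - f x') <= e)).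
  near=> d; split; first by near: d; exact: nbhs_right_gt.
  by near: d.
move=> /filter_ex [d [d0 hd]]; exists d => // z w Kz; exact: hd.
Unshelve. all: by end_near. Qed.

(** Squares stand in for discs because they are continuous images of products of two real
    intervals. *)
Lemma compact_square (r : R) :
  compact [set z : C | `|complex.Re z| <= r /\ `|complex.Im z| <= r].
Proof.
have -> : [set z : C | `|complex.Re z| <= r /\ `|complex.Im z| <= r] =
    (fun p : R * R => Complex p.1 p.2 : C) @` (`[- r, r] `*` `[- r, r]).
  apply/seteqP; split => [[x y] /= [hx hy]|z /= [[x y] /= [hx hy] <-]].
    by exists (x, y) => //=; rewrite !in_itv /= -!ler_norml.
  by rewrite !in_itv /= -!ler_norml in hx hy *.
apply: continuous_compact; last by apply: compact_setX; exact: segment_compact.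
apply: continuous_subspaceT => -[x y] P /nbhs_nmP [d d0 hd] /=.
exists (ball x (d / 2), ball y (d / 2)) => /=.
  by split; apply: nbhsx_ballx; rewrite divr_gt0.
move=> [x' y'] [/= hx hy]; apply: hd.
have -> : (Complex x' y' : C) - Complex x y = (Complex (x' - x) (y' - y) : C) by [].
rewrite (le_lt_trans (nm_Complex_le _ _))// [d]splitr ltrD//.
  by move: hx; rewrite /ball /= distrC.
by move: hy; rewrite /ball /= distrC.
Qed.

Lemma compact_line_segment {X : normedModType R[i]} (a b : X) :
  compact [set a + rc t *: (b - a) | t in `[0 : R, 1]].
Proof.
apply: continuous_compact; last exact: segment_compact.
apply: continuous_subspaceT => x P /nbhs_nmP [d d0 hd].
have c0 : 0 < nm (b - a) + 1 by rewrite ltr_wpDl ?nm_ge0.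
have -> : nbhs x = nbhs (x : R^o) by [].
apply/nbhs_ballP; exists (d / (nm (b - a) + 1)) => /=; first exact: divr_gt0.
move=> t; rewrite /ball /= => ht; apply: hd.
rewrite opprD addrACA subrr add0r -scalerBl -rcB nmZ nm_rc distrC.
have : `|x - t| * nm (b - a) <= `|x - t| * (nm (b - a) + 1).
  by rewrite ler_wpM2l// lerDl.
by move=> /le_lt_trans -> //; rewrite -ltr_pdivlMr.
Qed.

Section Differential.
Context {X Y : normedModType R[i]}.

Lemma continuous_nmP (f : X -> Y) : continuous f <->
  forall z (e : R), 0 < e -> exists2 d : R, 0 < d &
    forall w, nm (w - z) < d -> nm (f w - f z) <= e.
Proof.
split=> [cf z e e0|h z P /nbhs_nmP [e e0 he]].
  have /(_ _)/nbhs_nmP [] := cf z [set y | nm (y - f z) < e].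
    by apply/nbhs_nmP; exists e.
  by move=> d d0 hd; exists d => // w /hd /ltW.
have e20 : 0 < e / 2 by rewrite divr_gt0.
have [d d0 hd] := h z _ e20.
apply/nbhs_nmP; exists d => // w /hd hw; apply: he.
by rewrite (le_lt_trans hw)// ltr_pdivrMr// ltr_pMr// ltr1n.
Qed.

Lemma diff_nmP (f : X -> Y) (z : X) : differentiable f z ->
  forall e : R, 0 < e -> exists2 d : R, 0 < d &
    forall h, nm h <= d -> nm (f (z + h) - f z - 'd f z h) <= e * nm h.
Proof.
move=> /diff_locallyP [_ /eqaddoP hf] e e0.
have /nbhs_nmP [d d0 hd] := hf _ (rc_gt0 e0).
exists (d / 2); first by rewrite divr_gt0.
move=> h hh.
have := hd h; rewrite subr0 => /(_ _).
have hhd : nm h < d by rewrite (le_lt_trans hh)// ltr_pdivrMr// ltr_pMr// ltr1n.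
move=> /(_ hhd); rewrite /= !nmE -rcM lecR.
by rewrite !fctE /= (addrC h) opprD addrA.
Qed.

(** [differentiable] requires a continuous differential, and a linear map between arbitrary normed
    spaces need not be continuous; the bound by [M] provides this. Uniqueness of the differential
    then identifies it with [L]. *)
Lemma is_diff_of_bound (f L : X -> Y) (z : X) (M : R) : linear L ->
  (forall h, nm (L h) <= M * nm h) ->
  (forall e : R, 0 < e -> exists2 d : R, 0 < d &
    forall h, nm h <= d -> nm (f (z + h) - f z - L h) <= e * nm h) ->
  is_diff z f L.
Proof.
move=> lL hM hf.
pose L' : {linear X -> Y} := HB.pack L (GRing.isLinear.Build _ _ _ _ L lL).
have cL : continuous L'.
  apply/continuous_nmP => x e e0.
  have M0 : 0 < `|M| + 1 by rewrite ltr_wpDl.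
  exists (e / (`|M| + 1)); first by rewrite divr_gt0.
  move=> w hw; rewrite -linearB (le_trans (hM _))//.
  apply: (@le_trans _ _ ((`|M| + 1) * nm (w - x))).
    by rewrite ler_wpM2r ?nm_ge0// (le_trans (ler_norm _))// lerDl.
  by rewrite mulrC -ler_pdivlMr// ltW.
have fL : f \o shift z = cst (f z) + L' +o_ 0 id.
  apply/eqaddoP => _ /posc_realP [e e0 ->].
  have [d d0 hd] := hf _ e0.
  apply/nbhs_nmP; exists d => // h; rewrite subr0 => /ltW /hd.
  by rewrite /= !nmE -rcM lecR !fctE /= (addrC h) opprD addrA.
have hL : 'd f z = L' :> (X -> Y) by exact: diff_unique.
by split=> //; apply/diff_locallyP; rewrite hL.
Qed.

Lemma holomorphic_continuous (f : X -> Y) : holomorphic f -> continuous f.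
Proof. by move=> hf z; apply: differentiable_continuous. Qed.

End Differential.
End Topology.

Lemma exp2N_small {R : realType} (c d : R) : 0 < d ->
  exists n, c * 2^-1 ^+ n <= d.
Proof.
move=> d0; pose k := Num.truncn (c / d); exists k.+1.
have kc : c < k.+1%:R * d by rewrite -ltr_pdivrMr// truncnS_gt.
rewrite exprVn ler_pdivrMr ?exprn_gt0// (le_trans (ltW kc))// mulrC ler_pM2l//.
by rewrite -natrX ler_nat ltnW// ltn_expl.
Qed.

Lemma geometric_cauchy_cvg {R : realType} (s : nat -> Cplx R) :
  (forall n, nm (s n.+1 - s n) <= 2^-1 ^+ n.+1) ->
  exists l, forall n, nm (l - s n) <= 2^-1 ^+ n.
Proof.
move=> hs.
(* The finite geometric sum in closed form, which makes the induction on [k] exact. *)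
have hs2 n k : nm (s (n + k)%N - s n) <= 2^-1 ^+ n * (1 - 2^-1 ^+ k).
  elim: k => [|k ih]; first by rewrite addn0 subrr nm0 expr0 subrr mulr0.
  rewrite addnS (le_trans (nm_sub_trans (s (n + k)%N) _ _))//.
  rewrite (le_trans (lerD (hs _) ih))// -addnS exprD exprS.
  by move: (2^-1 ^+ n) (2^-1 ^+ k) => x y; rewrite le_eqVlt; apply/orP; left; apply/eqP; field.
have hs3 n m : (n <= m)%N -> nm (s m - s n) <= 2^-1 ^+ n.
  have h2 k : 0 <= (2^-1 : R) ^+ k by rewrite exprn_ge0// invr_ge0.
  by move=> /subnKC <-; rewrite (le_trans (hs2 _ _))// ler_piMr// gerBl.
have [l hl] : exists l, tends_to s l.
  apply: complex_cauchy_cvg => e e0.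
  have [N hN] := exp2N_small 2 e0.
  exists N => m n hm hn; rewrite (le_trans _ hN)// (le_trans (nm_sub_trans (s N) _ _))//.
  by rewrite mulr_natl mulr2n lerD ?hs3// nm_distC hs3.
exists l => n; exact: (tends_to_le hl (hs3 n)).
Qed.

(** * Primitives of closed holomorphic 1-forms *)

Section GoursatPoincare.
Context {R : realType} {X Y : normedModType R[i]}.
Local Notation C := (Cplx R).

Definition mid (a b : X) : X := (2^-1 : C) *: (a + b).

Lemma half_half (x : X) : (2^-1 : C) *: x + (2^-1 : C) *: x = x.
Proof. by rewrite -scalerDl -[X in X + X]div1r -splitr scale1r. Qed.

Lemma mid_subl a b : mid a b - a = (2^-1 : C) *: (b - a).
Proof.
by rewrite /mid -{2}(half_half a) scalerDr scalerBr opprD addrACA subrr add0r.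
Qed.

Lemma mid_sym a b : mid a b = mid b a. Proof. by rewrite /mid addrC. Qed.

Lemma mid_subr a b : b - mid a b = (2^-1 : C) *: (b - a).
Proof. by rewrite mid_sym -opprB mid_subl -scalerN opprB. Qed.

Lemma nm_half (x : X) : nm ((2^-1 : C) *: x) = nm x / 2.
Proof. by rewrite nmZ nmV nm_nat mulrC. Qed.

Lemma mid_closed_ball c (r : R) z w :
  nm (z - c) <= r -> nm (w - c) <= r -> nm (mid z w - c) <= r.
Proof.
move=> hz hw; rewrite /mid -{1}(half_half c) -scalerDr -scalerBr opprD addrACA.
rewrite nm_half ler_pdivrMr// (le_trans (nmD _ _))// mulr_natr mulr2n.
exact: lerD.
Qed.

Definition line (a b : X) : set X := [set a + rc t *: (b - a) | t in `[0 : R, 1]].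

Lemma line_l a b : line a b a.
Proof. by exists 0; rewrite ?rc0 ?scale0r ?addr0//= in_itv /= lexx ler01. Qed.

Lemma line_r a b : line a b b.
Proof. by exists 1; rewrite ?rc1 ?scale1r 1?addrC ?subrK//= in_itv /= lexx ler01. Qed.

Lemma line_mid a b z w : line a b z -> line a b w -> line a b (mid z w).
Proof.
move=> [s hs <-] [t ht <-]; exists (2^-1 * (s + t)).
  by move: hs ht; rewrite /= !in_itv /= => /andP[? ?] /andP[? ?]; lra.
rewrite /mid addrACA (scalerDr _ (a + a)) (scalerDr _ a a) half_half -scalerDl scalerA.
by congr (_ + _ *: _); rewrite -rcD rcM rcV rc_nat.
Qed.

Variables (b : Y -> X -> C) (M : R).
Hypothesis bBl : forall y y' v, b (y - y') v = b y v - b y' v.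
Hypothesis bDr : forall y v v', b y (v + v') = b y v + b y v'.
Hypothesis bZr : forall y a v, b y (a *: v) = a * b y v.
Hypothesis M0 : 0 <= M.
Hypothesis bM : forall y v, nm (b y v) <= M * nm y * nm v.

Let bNr y v : b y (- v) = - b y v.
Proof. by rewrite -scaleN1r bZr mulN1r. Qed.

Let bBr y v v' : b y (v - v') = b y v - b y v'.
Proof. by rewrite bDr bNr. Qed.

Variable V : X -> Y.

(** The [2 ^ n]-piece trapezoid rule for the 1-form [b (V z) dz]. It changes sign exactly under
    reversal, splits exactly at midpoints by its recursion, and has no error when [V] is affine with
    symmetric linear part. These are the properties that Goursat's bisection uses. *)
Fixpoint trapezoid (n : nat) (z w : X) : C :=
  if n is n'.+1 then trapezoid n' z (mid z w) + trapezoid n' (mid z w) w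
  else 2^-1 * (b (V z) (w - z) + b (V w) (w - z)).

Lemma trapezoid_rev n z w : trapezoid n w z = - trapezoid n z w.
Proof.
elim: n z w => [|n ih] z w /=.
  by rewrite -opprB !bNr -opprD mulrN [X in 2^-1 * X]addrC.
by rewrite mid_sym (ih z) (ih _ w) opprD addrC.
Qed.

(** Both the sum and [Phi w - Phi z] are additive under bisection and the two halves have half the
    length, so an error bound for one trapezoid survives every refinement with the same [B]. The set
    [Z] will be a ball or a segment. *)
Lemma trapezoid_bound (Z : set X) (Phi : X -> C) (B : R) :
  (forall z w, Z z -> Z w -> Z (mid z w)) ->
  (forall z w, Z z -> Z w -> nm (trapezoid 0 z w - (Phi w - Phi z)) <= B * nm (w - z)) ->
  forall n z w, Z z -> Z w -> nm (trapezoid n z w - (Phi w - Phi z)) <= B * nm (w - z).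
Proof.
move=> Zm h0; elim=> [|n ih] z w Zz Zw; first exact: h0.
have Zmm := Zm _ _ Zz Zw.
have -> : trapezoid n.+1 z w - (Phi w - Phi z) =
    (trapezoid n z (mid z w) - (Phi (mid z w) - Phi z)) +
    (trapezoid n (mid z w) w - (Phi w - Phi (mid z w))) by rewrite /=; ring.
rewrite (le_trans (nmD _ _))// (le_trans (lerD (ih _ _ Zz Zmm) (ih _ _ Zmm Zw)))//.
by rewrite mid_subl mid_subr nm_half -mulrDr -splitr.
Qed.

Lemma trapezoid_near_cst (Z : set X) c (B : R) n z w :
  (forall z w, Z z -> Z w -> Z (mid z w)) ->
  (forall z, Z z -> nm (V z - V c) <= B) -> Z z -> Z w ->
  nm (trapezoid n z w - b (V c) (w - z)) <= M * B * nm (w - z).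
Proof.
move=> Zm hB Zz Zw; rewrite bBr.
apply: (@trapezoid_bound Z (b (V c)) (M * B)) => //= z' w' hz hw.
have -> : 2^-1 * (b (V z') (w' - z') + b (V w') (w' - z')) - (b (V c) w' - b (V c) z')
    = 2^-1 * (b (V z' - V c) (w' - z') + b (V w' - V c) (w' - z')).
  by rewrite !bBl -!bBr; field.
rewrite nmM nmV nm_nat ler_pdivrMl// (le_trans (nmD _ _))// mulr_natl mulr2n.
by rewrite lerD// (le_trans (bM _ _))// ler_wpM2r ?nm_ge0// ler_wpM2l// hB.
Qed.

Hypothesis V_holo : holomorphic V.

Lemma trapezoid_cvg z w : exists l, tends_to (fun n => trapezoid n z w) l.
Proof.
apply: complex_cauchy_cvg => e e0.
have c0 : 0 < M * 2 * nm (w - z) + 1 by rewrite ltr_wpDl// !mulr_ge0// nm_ge0.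
(* Chosen so that the final bound [2 * (M * e') * nm (w - z)] is at most [e]; the summand 1 keeps
   the denominator positive. *)
pose e' := e / (M * 2 * nm (w - z) + 1).
have e'0 : 0 < e' by rewrite divr_gt0.
have [d d0 hd] := compact_unif_cont (@compact_line_segment _ _ z w)
  (holomorphic_continuous V_holo) e'0.
(* A piece of length at most [d] is compared with the constant form at its left end, for both
   refinements; a piece of length at most [d * 2 ^+ k] becomes such pieces after [k] halvings. *)
have claim k : forall x y, line z w x -> line z w y -> nm (y - x) <= d * 2 ^+ k ->
  forall m n, (k <= m)%N -> (k <= n)%N ->
  nm (trapezoid m x y - trapezoid n x y) <= 2 * (M * e') * nm (y - x).
  elim: k => [|k ih] x y hx hy hxy m n.
    move=> _ _; rewrite expr0 mulr1 in hxy.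
    rewrite (le_trans (nm_sub_trans (b (V x) (y - x)) _ _))//.
    rewrite (nm_distC (b _ _)) mulr_natl mulr2n mulrDl.
    have hs k : nm (trapezoid k x y - b (V x) (y - x)) <= M * e' * nm (y - x).
      apply: (trapezoid_near_cst (Z := [set q | nm (q - x) <= d])) => //=.
      - by move=> p q; exact: mid_closed_ball.
      - by move=> q hq; exact: hd.
      - by rewrite subrr nm0 ltW.
    exact: lerD.
  case: m n => [//|m] [//|n] hm hn /=.
  rewrite opprD addrACA (le_trans (nmD _ _))//.
  have hxy2 : nm (y - x) / 2 <= d * 2 ^+ k.
    by rewrite ler_pdivrMr// -mulrA -exprSr.
  have hmm := line_mid hx hy.
  apply: (@le_trans _ _ (2 * (M * e') * nm (mid x y - x) + 2 * (M * e') * nm (y - mid x y))).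
    by apply: lerD; apply: ih; rewrite // ?mid_subl ?mid_subr nm_half.
  by rewrite -mulrDr mid_subl mid_subr nm_half -splitr.
have [k hk] := exp2N_small (nm (w - z)) d0.
have {}hk : nm (w - z) <= d * 2 ^+ k.
  by rewrite exprVn ler_pdivrMr ?exprn_gt0// in hk.
exists k => m n hm hn.
apply: (le_trans (claim k _ _ (@line_l _ _) (@line_r _ _) hk _ _ hm hn)).
rewrite /e' (_ : _ * _ = e * ((M * 2 * nm (w - z)) / (M * 2 * nm (w - z) + 1))).
  by rewrite ler_piMr ?(ltW e0)// ler_pdivrMr// mul1r lerDl.
by field; rewrite gt_eqF.
Qed.

Definition integral_seg z w : C := projT1 (cid (trapezoid_cvg z w)).
Local Notation I := integral_seg.

Lemma integral_segP z w : tends_to (fun n => trapezoid n z w) (I z w).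
Proof. exact: projT2 (cid (trapezoid_cvg z w)). Qed.

Lemma integral_seg_rev z w : I w z = - I z w.
Proof.
rewrite -mulN1r; apply: tends_to_unique (integral_segP w z) _.
apply: tends_to_ext (tends_toZ (-1) (integral_segP z w)) => n.
by rewrite mulN1r -trapezoid_rev.
Qed.

Lemma integral_seg_split z w : I z w = I z (mid z w) + I (mid z w) w.
Proof.
apply: tends_to_unique (tends_to_shift (integral_segP z w)) _.
exact: tends_toD (integral_segP _ _) (integral_segP _ _).
Qed.

Lemma integral_seg_bound (Z : set X) (Phi : X -> C) (B : R) z w :
  (forall z w, Z z -> Z w -> Z (mid z w)) ->
  (forall z w, Z z -> Z w -> nm (trapezoid 0 z w - (Phi w - Phi z)) <= B * nm (w - z)) ->
  Z z -> Z w -> nm (I z w - (Phi w - Phi z)) <= B * nm (w - z).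
Proof.
move=> Zm h Zz Zw; apply: (tends_to_le (N := 0%N) (integral_segP z w)) => n _.
exact: (trapezoid_bound Zm).
Qed.

Hypothesis V_sym : forall z u v, b ('d V z u) v = b ('d V z v) u.

Section Triangle.
Variables u v : X.

Let J p (d : C) := I p (p + d *: u) + I (p + d *: u) (p + d *: v) + I (p + d *: v) p.

Let mid_add p x y : mid (p + x) (p + y) = p + (2^-1 : C) *: (x + y).
Proof. by rewrite /mid addrACA (scalerDr _ (p + p)) (scalerDr _ p p) half_half. Qed.

(** Subdivision of the triangle [p], [p + d u], [p + d v] by the midpoints of its sides. The central
    triangle is turned upside down, whence its negative scale; keeping [d] a scalar puts all four
    into one family. The inner sides cancel by reversal. *)
Lemma triangle_split p d : J p d = J p (2^-1 * d) + J (p + (2^-1 * d) *: u) (2^-1 * d)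
  + J (p + (2^-1 * d) *: v) (2^-1 * d)
  + J (p + (2^-1 * d) *: (u + v)) (- (2^-1 * d)).
Proof.
rewrite /J.
have hd x : p + (2^-1 * d) *: x + (2^-1 * d) *: x = p + d *: x.
  by rewrite -addrA -!scalerA half_half.
rewrite !hd.
rewrite [I p (p + d *: u)]integral_seg_split [I (p + d *: u) (p + d *: v)]integral_seg_split.
rewrite [I (p + d *: v) p]integral_seg_split.
have -> : mid p (p + d *: u) = p + (2^-1 * d) *: u.
  by rewrite -{1}(addr0 p) mid_add add0r scalerA.
have -> : mid (p + d *: v) p = p + (2^-1 * d) *: v.
  by rewrite -{2}(addr0 p) mid_add addr0 scalerA.
have -> : mid (p + d *: u) (p + d *: v) = p + (2^-1 * d) *: (u + v).
  by rewrite mid_add -scalerDr scalerA.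
have -> : p + (2^-1 * d) *: (u + v) + - (2^-1 * d) *: u = p + (2^-1 * d) *: v.
  by rewrite scaleNr -addrA -scalerBr addrAC subrr add0r.
have -> : p + (2^-1 * d) *: (u + v) + - (2^-1 * d) *: v = p + (2^-1 * d) *: u.
  by rewrite scaleNr -addrA -scalerBr addrK.
have -> : p + (2^-1 * d) *: u + (2^-1 * d) *: v = p + (2^-1 * d) *: (u + v).
  by rewrite -addrA -scalerDr.
have -> : p + (2^-1 * d) *: v + (2^-1 * d) *: u = p + (2^-1 * d) *: (u + v).
  by rewrite -addrA -scalerDr (addrC v).
rewrite (integral_seg_rev (p + (2^-1 * d) *: v) (p + (2^-1 * d) *: (u + v))).
rewrite (integral_seg_rev (p + (2^-1 * d) *: v) (p + (2^-1 * d) *: u)).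
rewrite (integral_seg_rev (p + (2^-1 * d) *: u) (p + (2^-1 * d) *: (u + v))).
move: (p + _) (p + _) => q1 q2.
ring.
Qed.

End Triangle.
Lemma triangle_local p (e : R) : 0 < e -> exists2 d : R, 0 < d &
  forall rho q x y, rho <= d -> nm (q - p) <= rho -> nm (x - p) <= rho ->
    nm (y - p) <= rho -> nm (I q x + I x y + I y q) <=
    M * e * rho * (nm (x - q) + nm (y - x) + nm (q - y)).
Proof.
move=> e0; have [d d0 hd] := diff_nmP (V_holo p) e0.
exists d => // rho q x y rd hq hx hy.
(* A primitive of the form with [V] replaced by its first-order expansion at [p]: the symmetry of
   [b ('d V p _) _] is what makes this quadratic function work. One trapezoid reproduces its
   increments exactly, so only the remainder of [V] contributes, and the increments cancel around
   the triangle. *)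
pose Phi z : C := b (V p) (z - p) + 2^-1 * b ('d V p (z - p)) (z - p).
have hI z w : nm (z - p) <= rho -> nm (w - p) <= rho ->
    nm (I z w - (Phi w - Phi z)) <= M * e * rho * nm (w - z).
  apply: (integral_seg_bound (Z := [set z | nm (z - p) <= rho])).
    by move=> ? ?; exact: mid_closed_ball.
  move=> {}z {}w /= hz hw.
  have hr z' : nm (z' - p) <= rho -> nm (V z' - V p - 'd V p (z' - p)) <= e * rho.
    move=> hz'; have := hd (z' - p) (le_trans hz' rd); rewrite [p + _]addrC subrK.
    by move=> /le_trans -> //; rewrite ler_wpM2l// ltW.
  have -> : 2^-1 * (b (V z) (w - z) + b (V w) (w - z)) - (Phi w - Phi z) =
      2^-1 * (b (V z - V p - 'd V p (z - p)) (w - z) +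
              b (V w - V p - 'd V p (w - p)) (w - z)).
    have -> : w - z = (w - p) - (z - p) by rewrite opprB addrA subrK.
    rewrite /Phi; move: (V_sym p (w - p) (z - p)).
    by move: (w - p) (z - p) => y' x'; rewrite !bBl !bBr => ->; field.
  rewrite nmM nmV nm_nat ler_pdivrMl// (le_trans (nmD _ _))// mulr_natl mulr2n.
  rewrite lerD// (le_trans (bM _ _))// ler_wpM2r ?nm_ge0// -mulrA ler_wpM2l//.
    exact: hr.
  exact: hr.
have -> : I q x + I x y + I y q = (I q x - (Phi x - Phi q)) +
   (I x y - (Phi y - Phi x)) + (I y q - (Phi q - Phi y)) by ring.
rewrite (le_trans (nmD _ _))// !mulrDr lerD ?hI//.
by rewrite (le_trans (nmD _ _))// lerD ?hI.
Qed.

(* Goursat's bisection: a nonzero integral over a triangle would produce nested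
   halved triangles whose integrals decay at most like the square of their
   size, while near the limit point the form is exact to first order. *)
Lemma triangle_integral0 p (u v : X) :
  I p (p + u) + I (p + u) (p + v) + I (p + v) p = 0.
Proof.
pose J q (d : C) := I q (q + d *: u) + I (q + d *: u) (q + d *: v) + I (q + d *: v) q.
pose P (s : C * C) := p + s.1 *: u + s.2 *: v.
apply: contrapT => /eqP; rewrite -nm_gt0; set K := nm _ => K0.
(* A state is a base point, given by two coefficients along [u] and [v], with a scale. Were all four
   parts not bad, their integrals would add up to less than [4 * K * (nm d / 2) ^+ 2], which is
   [K * nm d ^+ 2]. *)
pose bad (s : C * C * C) := K * nm s.2 ^+ 2 <= nm (J (P s.1) s.2).
(* The successor is quantified before the badness of [s], so that [choice] yields a total function
   to iterate. *)
have step (s : C * C * C) : exists s' : C * C * C, bad s -> [/\ bad s',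
   nm s'.2 = nm s.2 / 2, nm (s'.1.1 - s.1.1) <= nm s.2 / 2
   & nm (s'.1.2 - s.1.2) <= nm s.2 / 2].
  case: s => [[s t] d].
  have nd : nm (2^-1 * d) = nm d / 2 by rewrite nmM nmV nm_nat mulrC.
  have nN : nm (- (2^-1 * d)) = nm d / 2 by rewrite nmN.
  have n0 : 0 <= nm d / 2 by rewrite divr_ge0// nm_ge0.
  pose s1 : C * C * C := (s, t, 2^-1 * d).
  pose s2 : C * C * C := (s + 2^-1 * d, t, 2^-1 * d).
  pose s3 : C * C * C := (s, t + 2^-1 * d, 2^-1 * d).
  pose s4 : C * C * C := (s + 2^-1 * d, t + 2^-1 * d, - (2^-1 * d)).
  have [h1|h1] := pselect (bad s1).
    by exists s1 => _; split; rewrite //= subrr nm0.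
  have [h2|h2] := pselect (bad s2).
    by exists s2 => _; split; rewrite //= ?subrr ?nm0// addrAC subrr add0r nd.
  have [h3|h3] := pselect (bad s3).
    by exists s3 => _; split; rewrite //= ?subrr ?nm0// addrAC subrr add0r nd.
  have [h4|h4] := pselect (bad s4).
    by exists s4 => _; split; rewrite //= addrAC subrr add0r nd.
  exists s1; rewrite /bad /= => hbad; exfalso.
  move: h1 h2 h3 h4; rewrite /bad /= !nN !nd => /negP h1 /negP h2 /negP h3 /negP h4.
  rewrite -!ltNge in h1 h2 h3 h4.
  have hs : J (P (s, t)) d = J (P (s, t)) (2^-1 * d)
      + J (P (s + 2^-1 * d, t)) (2^-1 * d) + J (P (s, t + 2^-1 * d)) (2^-1 * d)
      + J (P (s + 2^-1 * d, t + 2^-1 * d)) (- (2^-1 * d)).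
    rewrite [LHS]triangle_split; congr (_ + J _ _ + J _ _ + J _ _).
    - by rewrite /P /= scalerDl addrA -!addrA; congr (_ + (_ + _)); rewrite addrC.
    - by rewrite /P /= scalerDl !addrA.
    - rewrite /P /= !scalerDl scalerDr -!addrA; congr (_ + (_ + _)).
      by rewrite addrCA.
  have : nm (J (P (s, t)) d) < K * (nm d / 2) ^+ 2 *+ 4.
    rewrite hs; apply: le_lt_trans (nmD _ _) _.
    rewrite (_ : _ *+ 4 = K * (nm d / 2) ^+ 2 + K * (nm d / 2) ^+ 2 +
      K * (nm d / 2) ^+ 2 + K * (nm d / 2) ^+ 2); last by ring.
    apply: ltrD => //; apply: le_lt_trans (nmD _ _) _; apply: ltrD => //.
    by apply: le_lt_trans (nmD _ _) _; apply: ltrD.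
  rewrite ltNge => /negP; apply.
  by rewrite (_ : _ *+ 4 = K * nm d ^+ 2)//; field.
have [next hnext] := choice step.
pose st n := iter n next ((0, 0, 1) : C * C * C).
have bad_st n : bad (st n) /\ nm (st n).2 = 2^-1 ^+ n.
  elim: n => [|n [ih1 ih2]].
    split; rewrite /= ?nm1 ?expr0//.
    by rewrite /bad /J /P /= nm1 expr1n mulr1 !scale0r !addr0 !scale1r.
  have [h1 h2 _ _] := hnext _ ih1; split=> //.
  by rewrite /= h2 ih2 exprS mulrC.
have hst n : nm ((st n.+1).1.1 - (st n).1.1) <= 2^-1 ^+ n.+1 /\
             nm ((st n.+1).1.2 - (st n).1.2) <= 2^-1 ^+ n.+1.
  have [h1 h2] := bad_st n; have [_ _] := hnext _ h1.
  by rewrite h2 exprS mulrC.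
have [s hs] := geometric_cauchy_cvg (fun n => (hst n).1).
have [t ht] := geometric_cauchy_cvg (fun n => (hst n).2).
pose L := nm u + nm v.
have L0 : 0 <= L by rewrite addr_ge0 ?nm_ge0.
(* Near the limit point, the triangle of scale [r] lies within [r * (2 * L)] and has perimeter at
   most [r * (2 * L)]. With local precision [K / (4 * M * L ^+ 2 + 1)] its integral is strictly
   below [K * r ^+ 2], against badness. *)
have D0 : 0 < 4 * M * L ^+ 2 + 1 by rewrite ltr_wpDl// !mulr_ge0// exprn_ge0.
have [d d0 hd] := triangle_local (P (s, t)) (divr_gt0 K0 D0).
have [n hn] := exp2N_small (2 * L) d0.
have [hbad hst2] := bad_st n.
move: (hs n) (ht n) hbad hst2; case: (st n) => [[s' t'] d'] /= hs' ht'.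
rewrite /bad /= => hbad nd; rewrite nd in hbad.
set r := 2^-1 ^+ n in hn hs' ht' hbad nd.
have r0 : 0 < r by rewrite exprn_gt0// invr_gt0.
have hP : nm (P (s', t') - P (s, t)) <= r * L.
  have -> : P (s', t') - P (s, t) = (s' - s) *: u + (t' - t) *: v.
    rewrite /P /= opprD addrACA -scalerBl opprD [p + _ + _]addrACA subrr add0r.
    by rewrite -scalerBl.
  rewrite (le_trans (nmD _ _))// !nmZ mulrDr.
  by apply: lerD; rewrite ler_wpM2r ?nm_ge0// nm_distC.
have hx x : nm x <= L -> nm (P (s', t') + d' *: x - P (s, t)) <= r * (2 * L).
  move=> hx; rewrite addrAC (le_trans (nmD _ _))// nmZ nd mulrCA mulr_natl mulr2n.
  by rewrite lerD// ler_wpM2l// ltW.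
have hJ : nm (J (P (s', t')) d') <= M * (K / (4 * M * L ^+ 2 + 1)) * (r * (2 * L)) * (r * (2 * L)).
  have h0 : nm (P (s', t') - P (s, t)) <= r * (2 * L).
    by have := hx 0; rewrite scaler0 addr0 nm0 => ->.
  apply: le_trans.
    apply: (hd (r * (2 * L))) => //.
    - by rewrite mulrC.
    - by apply: hx; rewrite lerDl nm_ge0.
    - by apply: hx; rewrite lerDr nm_ge0.
  rewrite ler_wpM2l//.
    by rewrite !mulr_ge0// ?(ltW r0)// ?invr_ge0 ltW.
  rewrite [X in nm (X - P _)]addrC addrK opprD addrACA subrr add0r -scalerBr.
  rewrite opprD addrA subrr add0r nmN !nmZ nd -!mulrDr ler_wpM2l ?(ltW r0)//.
  by have := nmB v u; rewrite /L; lra.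
have : K * r ^+ 2 <= M * (K / (4 * M * L ^+ 2 + 1)) * (r * (2 * L)) * (r * (2 * L)).
  exact: le_trans hbad hJ.
rewrite (_ : M * _ * _ * _ = K * r ^+ 2 * ((4 * M * L ^+ 2) / (4 * M * L ^+ 2 + 1))).
  rewrite leNgt => /negP; apply; rewrite gtr_pMr ?mulr_gt0 ?exprn_gt0//.
  by rewrite ltr_pdivrMr// mul1r ltrDl.
by field; rewrite gt_eqF.
Qed.

Definition primitive z := I 0 z.

(** By the vanishing triangle with vertices [0], [z], [w], the increment is the integral over the
    segment, which is compared with the constant form at [z]. This quantitative version is kept
    because uniformity in [z] is needed later, not only the differential. *)
Lemma primitive_bound z w (B : R) :
  (forall x, line z w x -> nm (V x - V z) <= B) ->
  nm (primitive w - primitive z - b (V z) (w - z)) <= M * B * nm (w - z).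
Proof.
move=> hB; have -> : primitive w - primitive z = I z w.
  have := triangle_integral0 0 z w; rewrite !add0r (integral_seg_rev 0 w) => /eqP.
  by rewrite subr_eq0 => /eqP h; rewrite /primitive -h addrC addKr.
apply: (tends_to_le (N := 0%N) (integral_segP z w)) => n _.
apply: (trapezoid_near_cst (Z := line z w)) => //.
- by move=> ? ?; exact: line_mid.
- exact: line_l.
- exact: line_r.
Qed.

Lemma exists_primitive : exists H : X -> C, forall z w (B : R),
  (forall x, line z w x -> nm (V x - V z) <= B) ->
  nm (H w - H z - b (V z) (w - z)) <= M * B * nm (w - z).
Proof. by exists primitive; exact: primitive_bound. Qed.

End GoursatPoincare.

(** * Interpolation at roots of unity and Cauchy estimates *)

Section OneVariable.
Context {R : realType}.
Local Notation C := (Cplx R).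

Lemma sqrt_right_half_plane (a : C) : exists s : C, s ^+ 2 = a /\ 0 <= complex.Re s.
Proof.
have [h|h] := leP 0 (complex.Re (sqrtc a)).
  by exists (sqrtc a); split => //; exact: sqr_sqrtc.
exists (- sqrtc a); split; first by rewrite sqrrN; exact: sqr_sqrtc.
by rewrite raddfN oppr_ge0 ltW.
Qed.

Lemma nm_sqr (a : C) : nm a ^+ 2 = complex.Re a ^+ 2 + complex.Im a ^+ 2.
Proof. by rewrite /nm normc_def /= sqr_sqrtr// addr_ge0 ?sqr_ge0. Qed.

(** Start from [-1], at squared distance 4 from 1, and take square roots [s] in the right
    half-plane. Since [nm s = 1] and [Re s >= 0], [nm (s + 1) ^+ 2 >= 2]; as
    [om - 1 = (s - 1) * (s + 1)], each root at least halves the squared distance. *)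
Lemma root_of_N1_near1 m : exists om : C,
  om ^+ (2 ^ m)%N = - 1 /\ nm (om - 1) ^+ 2 <= 4 * 2^-1 ^+ m.
Proof.
elim: m => [|m [om [h1 h2]]].
  exists (-1); split; first by rewrite expn0 expr1.
  by rewrite -opprD nmN -[1 + 1]/(2%:R) nm_nat expr0 mulr1 -natrX.
have [s [hs s0]] := sqrt_right_half_plane om.
exists s; split; first by rewrite expnS exprM hs.
have e : om - 1 = (s - 1) * (s + 1) by rewrite -hs; ring.
have h3 : 2 <= nm (s + 1) ^+ 2.
  have n1 : nm s = 1.
    apply/eqP; rewrite -(@pexpr_eq1 _ _ (2 ^ m.+1)) ?nm_ge0 ?expn_gt0//.
    by rewrite -nmX expnS exprM hs h1 nmN nm1.
  have := nm_sqr s; rewrite n1 expr1n nm_sqr raddfD /= => hn.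
  have -> : complex.Im (s + 1) = complex.Im s by rewrite raddfD /= addr0.
  by nra.
move: h2; rewrite e nmM exprMn (exprS _ m) => h2.
have := ler_wpM2l (sqr_ge0 (nm (s - 1))) h3.
move: h2; move: (nm (s - 1) ^+ 2) (nm (s + 1) ^+ 2) (2^-1 ^+ m) => x y q h2 h.
by have := le_trans h h2; lra.
Qed.

(** A number whose [2 ^ m]-th power is [-1] has order exactly [2 ^ m.+1]: the order is a power of 2
    dividing this one, and no smaller one will do. A root close to 1 makes consecutive nodes on the
    circle close. *)
Lemma exists_prim_root_near1 (e : R) : 0 < e -> exists N (om : C),
  [/\ (1 < N)%N, N.-primitive_root om, nm om = 1 & nm (om - 1) <= e].
Proof.
move=> e0; have [m hm] := exp2N_small 4 (exprn_gt0 2 e0).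
have [om [h1 h2]] := root_of_N1_near1 m.
exists (2 ^ m.+1)%N, om.
have hN : om ^+ (2 ^ m.+1)%N = 1 by rewrite expnSr exprM h1 sqrrN expr1n.
split.
- by rewrite -{1}(expn0 2) ltn_exp2l.
- have [d hd] := prim_order_exists (expn_gt0 2 m.+1) hN.
  move=> /(dvdn_pfactor _ _ (isT : prime 2)) [k hk ek].
  have [kl|] := leqP k m; last by move=> mk; rewrite -(_ : k = m.+1) ?ek// in hd *;
    apply/eqP; rewrite eqn_leq hk mk.
  exfalso; have : om ^+ (2 ^ m)%N = 1.
    by apply/eqP; rewrite -(prim_order_dvd hd) ek dvdn_exp2l.
  by move=> /eqP; rewrite h1 eq_sym -subr_eq0 opprK -[1 + 1]/(2%:R) pnatr_eq0.
- apply/eqP; rewrite -(@pexpr_eq1 _ _ (2 ^ m.+1)) ?nm_ge0 ?expn_gt0//.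
  by rewrite -nmX hN nm1.
- rewrite -(@ler_pXn2r _ 2) ?nnegrE ?nm_ge0 ?(ltW e0)//.
  exact: le_trans hm.
Qed.

Section Interpolation.
Variables (N : nat) (om : C) (r : R).
Hypotheses (N1 : (1 < N)%N) (prim : N.-primitive_root om) (om1 : nm om = 1)
  (r0 : 0 < r).

Let w (l : nat) : C := rc r * om ^+ l.

(* The Lagrange interpolation of [f] at the points [w l], written as a
   discretized Cauchy formula with truncated kernel. *)
Definition interp (f : C -> C) (z : C) : C :=
  N%:R^-1 * \sum_(l < N) f (w l) * \sum_(k < N) (z / w l) ^+ k.

Let NC0 : (N%:R : C) != 0.
Proof. by rewrite pnatr_eq0 -lt0n ltnW. Qed.

Let nm_w l : nm (w l) = r.
Proof. by rewrite nmM nmX om1 expr1n mulr1 nm_rc gtr0_norm. Qed.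

Let w_neq0 l : w l != 0.
Proof. by rewrite -nm_gt0 nm_w. Qed.

Lemma nm_average (g : nat -> C) (B : R) :
  (forall l, nm (g l) <= B) -> nm (N%:R^-1 * \sum_(l < N) g l) <= B.
Proof.
move=> hg; rewrite nmM nmV nm_nat ler_pdivrMl ?ltr0n 1?ltnW//.
rewrite (le_trans (nm_sum _ _ _))//.
have -> : N%:R * B = \sum_(l < N) B by rewrite sumr_const card_ord mulr_natl.
exact: ler_sum.
Qed.

Lemma geometric_sum_le (q : R) n : 0 <= q <= 2^-1 -> \sum_(k < n) q ^+ k <= 2.
Proof.
move=> /andP[q0 q1].
suff : \sum_(k < n) q ^+ k <= 2 * (1 - 2^-1 ^+ n).
  by move=> /le_trans -> //; rewrite ler_piMr// gerBl exprn_ge0// invr_ge0.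
elim: n => [|n ih]; first by rewrite big_ord0 expr0 subrr mulr0.
have hq : q ^+ n <= 2^-1 ^+ n by apply: lerXn2r; rewrite ?nnegrE ?invr_ge0.
rewrite big_ord_recr /= (le_trans (lerD ih hq))// exprS.
by move: (2^-1 ^+ n) => x; lra.
Qed.

Let quot_le (z : C) l : nm z <= r / 2 -> 0 <= nm (z / w l) <= 2^-1.
Proof.
by move=> hz; rewrite nm_ge0 nmM nmV nm_w ler_pdivrMr// mulrC.
Qed.

(** On the half disc the kernel is a geometric sum of ratio at most 1/2 in norm, so the factor 2
    does not depend on [N]. *)
Lemma interp_le f (z : C) (B : R) : nm z <= r / 2 ->
  (forall u, nm u = r -> nm (f u) <= B) -> nm (interp f z) <= 2 * B.
Proof.
move=> hz hf; apply: (nm_average (g := fun l => f (w l) * \sum_(k < N) (z / w l) ^+ k)) => l.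
rewrite nmM mulrC; apply: ler_pM; rewrite ?nm_ge0 ?hf ?nm_w//.
rewrite (le_trans (nm_sum _ _ _))//.
under eq_bigr do rewrite nmX.
exact/geometric_sum_le/quot_le.
Qed.

Lemma interp_sub f g z : interp (fun u => f u - g u) z = interp f z - interp g z.
Proof.
rewrite /interp -mulrBr -sumrB; congr (_ * _).
by apply: eq_bigr => l _; rewrite mulrBl.
Qed.

Lemma interp_scale a f z : interp (fun u => a * f u) z = a * interp f z.
Proof.
rewrite /interp [RHS]mulrCA; congr (_ * _); rewrite [RHS]mulr_sumr.
by apply: eq_bigr => l _; rewrite mulrA.
Qed.

(** Orthogonality of the characters of the cyclic group of order [N]. *)
Let sum_om_inv k : (k < N)%N ->
  \sum_(l < N) ((om ^+ l)^-1) ^+ k = if k == 0%N then N%:R else 0 :> C.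
Proof.
move=> kN; case: eqVneq => [->|k0].
  by under eq_bigr do rewrite expr0; rewrite sumr_const card_ord.
pose x : C := om^-1 ^+ k.
have x1 : x - 1 != 0.
  rewrite subr_eq0 /x exprVn invr_eq1 -(prim_order_dvd prim).
  by apply: contra k0 => /dvdn_leq; case: (k) kN => // k' kN /(_ isT); rewrite leqNgt kN.
have xN : x ^+ N = 1 by rewrite /x exprAC exprVn (prim_expr_order prim) invr1 expr1n.
apply: (mulfI x1); rewrite mulr0.
transitivity ((x - 1) * \sum_(l < N) x ^+ l).
  by congr (_ * _); apply: eq_bigr => l _; rewrite /x exprAC -exprVn.
by rewrite -subrX1 xN subrr.
Qed.

Let sum_w : \sum_(l < N) w l = 0.
Proof.
rewrite -mulr_sumr.
have x1 : om - 1 != 0.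
  rewrite subr_eq0 -(expr1 om) -(prim_order_dvd prim) gtnNdvd//.
by apply: (mulfI x1); rewrite mulr0 mulrCA -subrX1 (prim_expr_order prim) subrr mulr0.
Qed.

Section Homotopy.
Variables (F f : C -> C) (e d : R) (z : C).
Hypothesis d0 : 0 < d.
Hypothesis e0 : 0 <= e.
Hypothesis hF : forall u v, nm u <= r -> nm v <= r -> nm (v - u) <= d ->
  nm (F v - F u - f u * (v - u)) <= e * nm (v - u).
Hypothesis hom : r * nm (om - 1) <= d.
Hypothesis hz : nm z <= r / 2.

Let p (t : R) l : C := z + rc t * (w l - z).

Let p_disc t l : 0 <= t <= 1 -> nm (p t l) <= r.
Proof.
move=> /andP[t0 t1].
have -> : p t l = rc (1 - t) * z + rc t * w l by rewrite /p rcB rc1; ring.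
rewrite (le_trans (nmD _ _))// (nmM (rc t)) nmM nm_w !nm_rc ger0_norm ?subr_ge0// ger0_norm//.
have : nm z <= r by rewrite (le_trans hz)// ler_pdivrMr// ler_pMr// ler1n.
by nra.
Qed.

(** Up to the factor [N * (om - 1)], a Riemann sum for the integral of [f (z + t (w - z)) dw] over
    the circle. *)
Let S t : C := N%:R^-1 * \sum_(l < N) f (p t l) * w l.

(** Multiplied by [rc t * (om - 1)], each term is [f] times a side of the closed polygon [p t],
    hence nearly an increment of [F], and these increments telescope to 0. The error of a side is
    proportional to its length, so dividing back leaves a bound independent of [t] and [N]. At
    [t = 0] the polygon degenerates and the nodes sum to 0. *)
Let S_le t : 0 <= t <= 1 -> nm (S t) <= r * e.
Proof.
move=> ht; have /andP[t0 t1] := ht.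
have om10 : 0 < nm (om - 1).
  by rewrite nm_gt0 subr_eq0 -(expr1 om) -(prim_order_dvd prim) gtnNdvd.
have [->|tn0] := eqVneq t 0.
  rewrite /S /p rc0; under eq_bigr do rewrite mul0r addr0.
  by rewrite -mulr_sumr sum_w !mulr0 nm0 mulr_ge0// ltW.
have tp : 0 < t by rewrite lt_neqAle eq_sym tn0.
have step l : p t l.+1 - p t l = rc t * (om - 1) * w l.
  by rewrite /p /w exprS; ring.
have nstep l : nm (p t l.+1 - p t l) = t * nm (om - 1) * r.
  by rewrite step nmM nm_w nmM nm_rc gtr0_norm.
have tel : \sum_(l < N) (F (p t l.+1) - F (p t l)) = 0.
  have := telescope_sumr (fun l => F (p t l)) (leq0n N); rewrite big_mkord => ->.
  have -> : p t N = p t 0 by rewrite /p /w (prim_expr_order prim) expr0.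
  by rewrite subrr.
have -> : S t = - (rc t * (om - 1))^-1 * (N%:R^-1 * \sum_(l < N)
    (F (p t l.+1) - F (p t l) - f (p t l) * (p t l.+1 - p t l))).
  rewrite sumrB tel sub0r !mulrN mulNr opprK /S mulrCA; congr (_ * _).
  rewrite mulr_sumr; apply: eq_bigr => l _; rewrite step.
  have o1 : om - 1 != 0 by rewrite -nm_gt0.
  have t1' : rc t != 0 by rewrite -nm_gt0 nm_rc gtr0_norm.
  by field; rewrite o1 t1'.
rewrite nmM nmN nmV nmM nm_rc gtr0_norm// ler_pdivrMl ?mulr_gt0//.
rewrite (_ : t * _ * (r * e) = e * (t * nm (om - 1) * r)); last by ring.
apply: (nm_average (g := fun l => F (p t l.+1) - F (p t l) - f (p t l) * (p t l.+1 - p t l))) => l.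
rewrite -(nstep l); apply: hF; rewrite ?p_disc// nstep -mulrA mulrC (mulrC _ r).
by rewrite (le_trans _ hom)// ler_piMr// mulr_ge0 ?nm_ge0// ltW.
Qed.

Let wz0 l : w l - z != 0.
Proof.
rewrite subr_eq0; apply: contraTneq hz => <-; rewrite nm_w -ltNge ltr_pdivrMr//.
by rewrite ltr_pMr// ltr1n.
Qed.

(** The discretized Cauchy integral of [F (z + t (w - z)) dw / (w - z)], which deforms the integral
    for [F] at [t = 1] into that of the constant [F z] at [t = 0]. *)
Let E t : C := N%:R^-1 * \sum_(l < N) F (p t l) * (w l / (w l - z)).

(** To first order [E] moves by [s * S t], since [w - z] cancels; it also cancels in the error term,
    whatever the distance of the node to [z]. Each contributes [s * (r * e)]. *)
Let E_step t s : 0 <= t <= 1 -> 0 <= s -> t + s <= 1 -> s * (2 * r) <= d ->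
  nm (E (t + s) - E t) <= s * (2 * (r * e)).
Proof.
move=> ht s0 ts hs; have /andP[t0 t1] := ht.
have hts : 0 <= t + s <= 1 by rewrite ts addr_ge0.
pose err l : C := F (p (t + s) l) - F (p t l) - f (p t l) * (p (t + s) l - p t l).
have dp l : p (t + s) l - p t l = rc s * (w l - z).
  by rewrite /p rcD; ring.
have -> : E (t + s) - E t = rc s * S t +
    N%:R^-1 * \sum_(l < N) err l * (w l / (w l - z)).
  rewrite /E /S -mulrBr -sumrB [rc s * _]mulrCA -mulrDr; congr (_ * _).
  rewrite mulr_sumr -big_split /=; apply: eq_bigr => l _.
  by rewrite /err dp; have := wz0 l; move: (w l - z) => q q0; field.
rewrite (le_trans (nmD _ _))// mulr_natl mulr2n mulrDr nmM nm_rc (ger0_norm s0).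
rewrite lerD ?ler_wpM2l ?S_le//.
apply: (nm_average (g := fun l => err l * (w l / (w l - z)))) => l.
rewrite nmM nmM nmV nm_w.
have wz : 0 < nm (w l - z) by rewrite nm_gt0.
rewrite mulrA ler_pdivrMr//.
have : nm (err l) <= e * nm (p (t + s) l - p t l).
  apply: hF; rewrite ?p_disc// dp nmM nm_rc (ger0_norm s0) (le_trans _ hs)// ler_wpM2l//.
  rewrite (le_trans (nmB _ _))// nm_w mulr_natl mulr2n lerD2l (le_trans hz)//.
  by rewrite ler_pdivrMr// ler_pMr// ler1n.
rewrite dp nmM nm_rc (ger0_norm s0) => /(ler_wpM2r (ltW r0)) /le_trans -> //.
by rewrite le_eqVlt; apply/orP; left; apply/eqP; ring.
Qed.

Let E_01 : nm (E 1 - E 0) <= 2 * (r * e).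
Proof.
(* Enough equal steps for every point, moving at speed at most [2 * r], to stay within [d] per
   step. *)
pose m := (Num.truncn (2 * r / d)).+1.
have hm : 2 * r < m%:R * d by rewrite -ltr_pdivrMr// truncnS_gt.
have m0 : 0 < m%:R :> R by rewrite ltr0n.
have s0 : 0 <= m%:R^-1 :> R by rewrite invr_ge0 ltW.
suff h j : (j <= m)%N -> nm (E (j%:R / m%:R) - E 0) <= j%:R / m%:R * (2 * (r * e)).
  by have := h m (leqnn m); rewrite divff ?gt_eqF// mul1r.
elim: j => [_|j ih jm]; first by rewrite mul0r subrr nm0 mul0r.
have jm1 : (j.+1%:R : R) / m%:R <= 1 by rewrite ler_pdivrMr// mul1r ler_nat.
have js : (j.+1%:R : R) / m%:R = j%:R / m%:R + m%:R^-1.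
  by rewrite -natr1 mulrDl mul1r.
rewrite (le_trans (nm_sub_trans (E (j%:R / m%:R)) _ _))// js mulrDl addrC lerD//.
  by rewrite ih// ltnW.
apply: E_step => //.
- rewrite mulr_ge0//= ler_pdivrMr// mul1r ler_nat ltnW//.
- by rewrite -js.
- by rewrite mulrC ler_pdivrMr// [d * _]mulrC ltW.
Qed.

(* Discrete form of the homotopy [t |-> \oint F (z + t (w - z)) dw / (w - z)],
   whose derivative [\oint f (z + t (w - z)) dw] vanishes as [f = F']. *)
Lemma interp_primitive_le : nm (interp F z - F z) <= 4 * r * e.
Proof.
(* Correction for truncating the kernel at [N] terms. It does not depend on the node because
   [w l ^+ N] is [r ^ N] for all [l]; its norm is at most 2. *)
pose cc : C := 1 - (z / rc r) ^+ N.
have rC0 : rc r != 0 by rewrite -nm_gt0 nm_rc gtr0_norm.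
have hcc l : cc * (w l / (w l - z)) = \sum_(k < N) (z / w l) ^+ k.
  have -> : cc = 1 - (z / w l) ^+ N.
    rewrite /cc !expr_div_n /w exprMn exprAC (prim_expr_order prim) expr1n mulr1//.
  have zw1 : z / w l - 1 != 0.
    rewrite -(mulIr_eq0 _ (mulIf (w_neq0 l))) mulrBl divfK// mul1r -opprB oppr_eq0.
    exact: wz0.
  apply: (mulfI zw1); rewrite -subrX1.
  have := wz0 l; have := w_neq0 l; move: (_ ^+ _) => q h1 h2.
  by field; rewrite h1 h2.
have h1 : interp F z = cc * E 1.
  rewrite /interp /E [RHS]mulrCA; congr (_ * _); rewrite [RHS]mulr_sumr; apply: eq_bigr => l _.
  by rewrite /p rc1 mul1r addrC subrK mulrCA hcc.
(* Interpolation reproduces constants: by orthogonality only the term [k = 0] of the kernel survives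
   the average. *)
have h0 : F z = cc * E 0.
  rewrite /E; under eq_bigr do rewrite /p rc0 mul0r addr0.
  rewrite -mulr_sumr mulrCA (mulrCA cc) mulr_sumr; under eq_bigr do rewrite hcc.
  rewrite exchange_big /=.
  have -> : \sum_(k < N) \sum_(l < N) (z / w l) ^+ k = N%:R :> C.
    transitivity (\sum_(k < N) (z / rc r) ^+ k * (if k == 0%N :> nat then N%:R else 0)).
      apply: eq_bigr => k _; rewrite -(sum_om_inv (ltn_ord k)) mulr_sumr.
      by apply: eq_bigr => l _; rewrite /w invfM mulrA exprMn.
    rewrite (bigD1 (Ordinal (ltnW N1))) //= expr0 mul1r big1 ?addr0// => i i0.
    case: eqP => [hi|_]; last by rewrite mulr0.
    by move: i0; rewrite -val_eqE /= hi.
  by have := NC0; move: (N%:R : C) => q q0; field.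
have -> : interp F z - F z = cc * (E 1 - E 0) by rewrite h1 [X in _ - X]h0 mulrBr.
rewrite nmM (_ : 4 * r * e = 2 * (2 * (r * e))); last by ring.
apply: ler_pM; rewrite ?nm_ge0//.
rewrite (le_trans (nmB _ _))// nm1 (_ : 2 = 1 + 1 :> R)// lerD2l nmX exprn_ile1 ?nm_ge0//.
rewrite nmM nmV nm_rc gtr0_norm// ler_pdivrMr// mul1r (le_trans hz)//.
by rewrite ler_pdivrMr// ler_pMr// ler1n.
Qed.

End Homotopy.
End Interpolation.
End OneVariable.

(** * Convergence of interpolation and Cauchy estimates in one variable *)

Section CauchyEstimates.
Context {R : realType}.
Local Notation C := (Cplx R).

Lemma line_nm {X : normedModType R[i]} (z w x : X) : line z w x -> nm (x - z) <= nm (w - z).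
Proof.
move=> [t]; rewrite /= in_itv /= => /andP[t0 t1] <-.
by rewrite addrC addKr nmZ nm_rc ger0_norm// ler_piMl ?nm_ge0.
Qed.

(** The symmetry that Goursat's argument requires is automatic here: a complex linear map of the
    line is multiplication by a scalar. *)
Lemma entire_primitive (f : C -> C) : holomorphic f -> exists F : C -> C,
  forall z w (B : R), (forall x, nm (x - z) <= nm (w - z) -> nm (f x - f z) <= B) ->
  nm (F w - F z - f z * (w - z)) <= B * nm (w - z).
Proof.
move=> hf.
have [||||||F hF] := @exists_primitive R C C (fun y v => y * v) 1 _ _ _ _ _ f hf _.
- by move=> y y' v; rewrite mulrBl.
- by move=> y v v'; rewrite mulrDr.
- by move=> y a v; rewrite mulrCA.
- exact: ler01.
- by move=> y v; rewrite mul1r nmM.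
- move=> z u v.
  have h x : 'd f z x = x * 'd f z 1.
    by rewrite -[x in LHS]mulr1 -[x * 1]/(x *: (1 : C)) linearZ.
  by rewrite h (h v); ring.
- exists F => z w B hB; rewrite -[B]mul1r; apply: hF => x /line_nm; exact: hB.
Qed.

(** Families are needed because, in several variables, one [N] and one root [om] must serve all
    slices of a function over a polydisc. *)
Definition equicontinuous_on_discs (FF : set (C -> C)) : Prop :=
  forall rho e : R, 0 < e -> exists2 d : R, 0 < d & forall f, FF f ->
    forall u v, nm u <= rho -> nm (v - u) <= d -> nm (f v - f u) <= e.

(* [f] is close to the difference quotient of its primitive [F], and
   interpolation commutes with difference quotients. *)
Lemma interp_cvg (FF : set (C -> C)) (r e : R) :
  (forall f, FF f -> holomorphic f) -> equicontinuous_on_discs FF ->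
  0 < r -> 0 < e -> exists N (om : C), [/\ (1 < N)%N, N.-primitive_root om, nm om = 1 &
    forall f z, FF f -> nm z <= r / 2 -> nm (interp N om r f z - f z) <= e].
Proof.
(* The error is made of [2 * e1] from interpolating [f - fh], [8 * e1] from the two interpolated
   primitives, and [e1] from [f - fh] at [z]. *)
move=> holo equi r0 e0; pose e1 := e / 11.
have e10 : 0 < e1 by rewrite divr_gt0.
have [eta eta0 heta] := equi r e1 e10.
(* Dividing two errors [4 * r * e2] by the step [eta] must give [8 * e1]. The next line works on
   radius [r + eta] because the primitive is also interpolated after translation by [h]. *)
pose e2 := e1 * eta / r.
have e20 : 0 < e2 by rewrite divr_gt0// mulr_gt0.
have [d d0 hd] := equi (r + eta) e2 e20.
have [N [om [N1 prim om1 hom]]] := exists_prim_root_near1 (divr_gt0 d0 r0).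
rewrite ler_pdivlMr// mulrC in hom.
exists N, om; split=> // f z Ff hz.
have [F hF] := entire_primitive (holo _ Ff).
pose h : C := rc eta.
have nh : nm h = eta by rewrite nm_rc gtr0_norm.
have h0 : h != 0 by rewrite -nm_gt0 nh.
pose fh u := h^-1 * (F (u + h) - F u).
have hfh u : nm u <= r -> nm (f u - fh u) <= e1.
  move=> ur; have := hF u (u + h) e1; rewrite [u + h]addrC addrK nh => hh.
  have {}hh : nm (F (h + u) - F u - f u * h) <= e1 * eta by apply: hh => x; exact: heta.
  have -> : f u - fh u = - h^-1 * (F (h + u) - F u - f u * h).
    by rewrite /fh (addrC u); field.
  by rewrite nmM nmN nmV nh ler_pdivrMl// [eta * e1]mulrC.
have zr : nm z <= r by rewrite (le_trans hz)// ler_pdivrMr// ler_pMr// ler1n.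
have A1 : nm (interp N om r F z - F z) <= 4 * r * e2.
  apply: (@interp_primitive_le _ _ _ _ N1 prim om1 r0 _ f e2 d) => //; first exact: ltW.
  move=> u v ur vr uv; apply: hF => x xu; apply: hd => //.
    by rewrite (le_trans ur)// lerDl ltW.
  exact: le_trans uv.
have A2 : nm (interp N om r (fun u => F (u + h)) z - F (z + h)) <= 4 * r * e2.
  apply: (@interp_primitive_le _ _ _ _ N1 prim om1 r0 _ (fun u => f (u + h)) e2 d) => //; first exact: ltW.
  move=> u v ur vr uv.
  have := hF (u + h) (v + h) e2.
  have -> : v + h - (u + h) = v - u by ring.
  apply=> x xu; apply: hd => //.
    by rewrite (le_trans (nmD _ _))// nh lerD2r.
  exact: le_trans uv.
have A3 : nm (interp N om r (fun u => f u - fh u) z) <= 2 * e1.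
  by apply: interp_le => // u ur; apply: hfh; rewrite ur.
have -> : interp N om r f z - f z = interp N om r (fun u => f u - fh u) z
   + h^-1 * ((interp N om r (fun u => F (u + h)) z - F (z + h))
             - (interp N om r F z - F z)) + - (f z - fh z).
  by rewrite interp_sub /fh interp_scale interp_sub; ring.
have A4 : nm (h^-1 * ((interp N om r (fun u => F (u + h)) z - F (z + h))
             - (interp N om r F z - F z))) <= 8 * e1.
  rewrite nmM nmV nh ler_pdivrMl// (le_trans (nmB _ _))//.
  rewrite (le_trans (lerD A2 A1))// /e2 le_eqVlt; apply/orP; left; apply/eqP.
  by field; rewrite gt_eqF.
rewrite (le_trans (nmD _ _))// nmN.
have -> : e = 2 * e1 + 8 * e1 + e1 by rewrite /e1; field.
rewrite lerD ?hfh//.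
by rewrite (le_trans (nmD _ _))// lerD.
Qed.

Lemma disc_sub_square (r : R) (z : C) : nm z <= r ->
  `|complex.Re z| <= r /\ `|complex.Im z| <= r.
Proof.
by move=> h; rewrite (le_trans (nm_Re_le _) h) (le_trans (nm_Im_le _) h).
Qed.

Lemma entire_equicontinuous (g : C -> C) : holomorphic g ->
  equicontinuous_on_discs [set g].
Proof.
move=> hg rho e e0.
have [d d0 hd] := compact_unif_cont (@compact_square R rho) (holomorphic_continuous hg) e0.
by exists d => // f -> u v /disc_sub_square; exact: hd.
Qed.

Lemma geometric_recl2 (x : C) n :
  \sum_(k < n.+2) x ^+ k = 1 + x + x ^+ 2 * \sum_(k < n) x ^+ k.
Proof.
rewrite !big_ord_recl expr0 expr1 addrA; congr (_ + _).
by rewrite mulr_sumr; apply: eq_bigr => k _; rewrite -exprD.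
Qed.

Section OneFunction.
Variables (g : C -> C) (r B : R).
Hypotheses (hg : holomorphic g) (r0 : 0 < r)
  (hB : forall u, nm u = r -> nm (g u) <= B).

Let approx (e : R) : 0 < e -> exists N (om : C),
  [/\ (1 < N)%N, N.-primitive_root om, nm om = 1 &
    forall z, nm z <= r / 2 -> nm (interp N om r g z - g z) <= e].
Proof.
move=> e0.
have hh : forall f, [set g] f -> holomorphic f by move=> f ->.
have [N [om [? ? ? h]]] := interp_cvg hh (entire_equicontinuous hg) r0 e0.
by exists N, om; split=> // z; apply: h.
Qed.

Let B0 : 0 <= B.
Proof. by rewrite (le_trans (nm_ge0 _) (hB (u := rc r) _))// nm_rc gtr0_norm. Qed.

(** The interpolation polynomial has explicit coefficients, so its linear coefficient [a] and
    quadratic remainder obey Cauchy bounds directly. [N] is at least 2, so the kernel does contain a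
    linear term. *)
Let interp_expand N (om : C) : (1 < N)%N -> nm om = 1 ->
  exists a : C, nm a <= B / r /\ forall h, nm h <= r / 2 ->
    nm (interp N om r g h - interp N om r g 0 - a * h) <= 2 * B * nm h ^+ 2 / r ^+ 2.
Proof.
move=> N1 om1.
pose w l : C := rc r * om ^+ l.
have nw l : nm (w l) = r by rewrite /w nmM nmX om1 expr1n mulr1 nm_rc gtr0_norm.
case: N N1 => [//|[//|N]] N1.
exists (N.+2%:R^-1 * \sum_(l < N.+2) g (w l) / w l); split.
  apply: (nm_average N1 (g := fun l => g (w l) / w l)) => l.
  by rewrite nmM nmV nw ler_wpM2r ?hB// invr_ge0 ltW.
move=> h hh.
have -> : interp N.+2 om r g h - interp N.+2 om r g 0 -
    N.+2%:R^-1 * (\sum_(l < N.+2) g (w l) / w l) * h =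
    N.+2%:R^-1 * (\sum_(l < N.+2) g (w l) * ((h / w l) ^+ 2 * \sum_(k < N) (h / w l) ^+ k)).
  rewrite /interp -mulrA -!mulrBr; congr (_ * _).
  rewrite mulr_suml -!sumrB; apply: eq_bigr => l _; rewrite -/(w l).
  rewrite !geometric_recl2 mul0r expr0n /= mul0r !addr0.
  by move: (\sum_(k < N) _) => q; ring.
apply: (nm_average N1 (g := fun l => g (w l) * ((h / w l) ^+ 2 * \sum_(k < N) (h / w l) ^+ k))) => l.
rewrite (nmM (g _)) (nmM (_ ^+ 2)) nmX nmM nmV nw.
have : nm (\sum_(k < N) (h / w l) ^+ k) <= 2.
  rewrite (le_trans (nm_sum _ _ _))//; under eq_bigr do rewrite nmX.
  by apply: geometric_sum_le; rewrite nm_ge0 nmM nmV nw ler_pdivrMr// mulrC.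
have q0 : 0 <= (nm h / r) ^+ 2 by rewrite exprn_ge0// divr_ge0 ?nm_ge0// ltW.
move=> /(ler_wpM2l q0) hs.
have := ler_pM (nm_ge0 _) (mulr_ge0 q0 (nm_ge0 _)) (hB (nw l)) hs.
move=> /le_trans -> //.
by rewrite expr_div_n le_eqVlt; apply/orP; left; apply/eqP; ring.
Qed.

Let D := 'd g 0 (1 : C).

Let diffE (h : C) : 'd g 0 h = D * h.
Proof. by rewrite -[h in LHS]mulr1 -[h * 1]/(h *: (1 : C)) linearZ mulrC. Qed.

(** Uniform closeness of [g] to its interpolation says nothing directly about derivatives. Both [a]
    and [D] are therefore compared with the increment of [g] over one small step [k], with an
    interpolation error small relative to [k]. *)
Let cauchy_approx (eta : R) : 0 < eta -> exists a : C, [/\ nm a <= B / r,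
  nm (a - D) <= eta & forall h, nm h <= r / 2 ->
    nm (g h - g 0 - a * h) <= 2 * B * nm h ^+ 2 / r ^+ 2 + eta].
Proof.
move=> eta0; pose c := 2 * B / r ^+ 2.
have c0 : 0 <= c by rewrite divr_ge0 ?mulr_ge0 ?exprn_ge0// ltW.
pose e1 := eta / (c + 3).
have e10 : 0 < e1 by rewrite divr_gt0// ltr_wpDl.
have [d d0 hd] := diff_nmP (hg 0) e10.
(* [k <= d] gives the differential estimate at 0, [k <= r / 2] the interpolation estimate, [k <= e1]
   turns [c * k + 2 * e1] into at most [eta], and [k <= 1] bounds the error [e1 * k] for the other
   [h]. *)
pose k := Num.min (Num.min d (r / 2)) (Num.min e1 1).
have k0 : 0 < k by rewrite !lt_min d0 divr_gt0// e10 ltr01.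
have [kd kr ke k1] : [/\ k <= d, k <= r / 2, k <= e1 & k <= 1].
  by rewrite /k !ge_min !lexx !orbT.
have ek0 : 0 < e1 * k / 2 by rewrite divr_gt0// mulr_gt0.
have [N [om [N1 prim om1 hN]]] := approx ek0.
have [a [ha hh]] := interp_expand N1 om1.
have hr h : nm h <= r / 2 -> nm (g h - g 0 - a * h) <= c * nm h ^+ 2 + e1 * k.
  move=> hhr.
  have -> : g h - g 0 - a * h = (interp N om r g h - interp N om r g 0 - a * h)
     + ((interp N om r g 0 - g 0) - (interp N om r g h - g h)) by ring.
  rewrite (le_trans (nmD _ _))// lerD//.
    by rewrite (le_trans (hh _ hhr))// le_eqVlt; apply/orP; left; apply/eqP; rewrite /c; ring.
  rewrite (le_trans (nmB _ _))// [e1 * k]splitr lerD ?hN// nm0 divr_ge0// ltW//.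
exists a; split=> //.
  have nk : nm (rc k) = k by rewrite nm_rc gtr0_norm.
  have h1 := hr (rc k); rewrite nk in h1.
  have h2 := hd (rc k); rewrite nk add0r diffE in h2.
  have h3 : nm ((a - D) * rc k) <= (c * k ^+ 2 + e1 * k) + e1 * k.
    have -> : (a - D) * rc k = (g (rc k) - g 0 - D * rc k) - (g (rc k) - g 0 - a * rc k).
      by ring.
    by rewrite (le_trans (nmB _ _))// addrC lerD ?h1 ?h2.
  rewrite nmM nk -ler_pdivlMr// in h3; rewrite (le_trans h3)//.
  have -> : (c * k ^+ 2 + e1 * k + e1 * k) / k = c * k + 2 * e1 by field; rewrite gt_eqF.
  have -> : eta = (c + 3) * e1 by rewrite /e1 mulrC divfK// gt_eqF// ltr_wpDl.
  by nra.
move=> h /hr /le_trans -> //.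
have -> : eta = (c + 3) * e1 by rewrite /e1 mulrC divfK// gt_eqF// ltr_wpDl.
rewrite (_ : 2 * B * nm h ^+ 2 / r ^+ 2 = c * nm h ^+ 2); last by rewrite /c; ring.
by rewrite lerD2l; nra.
Qed.

Lemma cauchy_estimate (h : C) : nm ('d g 0 h) <= B / r * nm h.
Proof.
rewrite diffE nmM ler_wpM2r ?nm_ge0//; apply/ler_addgt0Pr => e e0.
have [a [ha hD _]] := cauchy_approx e0.
rewrite (_ : D = a - (a - D)); last by ring.
by rewrite (le_trans (nmB _ _))// lerD.
Qed.

(** A Taylor remainder with a constant depending only on the bound [B], hence stable under limits of
    functions. *)
Lemma cauchy_estimate2 (h : C) : nm h <= r / 2 ->
  nm (g h - g 0 - 'd g 0 h) <= 2 * B * nm h ^+ 2 / r ^+ 2.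
Proof.
move=> hh; rewrite diffE; apply/ler_addgt0Pr => e e0.
have e'0 : 0 < e / (1 + nm h) by rewrite divr_gt0// ltr_pwDl ?nm_ge0.
have [a [_ hD ha]] := cauchy_approx e'0.
have -> : g h - g 0 - D * h = (g h - g 0 - a * h) + (a - D) * h by ring.
rewrite (le_trans (nmD _ _))// (le_trans (lerD (ha _ hh) (lexx _)))// -addrA lerD2l.
rewrite nmM (le_trans (lerD (lexx _) (ler_wpM2r (nm_ge0 _) hD)))//.
rewrite -[X in X + _]mulr1 -mulrDr divfK// gt_eqF// ltr_pwDl ?nm_ge0//.
Qed.

End OneFunction.
End CauchyEstimates.

(** * Cauchy estimates in normed spaces, by restriction to complex lines *)

Section DirectionalEstimates.
Context {R : realType} {X : normedModType R[i]}.
Local Notation C := (Cplx R).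

Lemma is_diff_line (z v : X) (t : C) :
  is_diff t (fun s : C => z + s *: v) (fun s : C => s *: v).
Proof.
apply: (is_diff_of_bound (M := nm v)).
- by move=> a x y; rewrite scalerDl scalerA.
- by move=> h; rewrite nmZ mulrC.
- move=> e e0; exists 1 => // h _.
  have -> : z + (t + h) *: v - (z + t *: v) - h *: v = 0.
    by rewrite scalerDl addrA [_ + h *: v]addrC addrK subrr.
  by rewrite nm0 mulr_ge0 ?nm_ge0// ltW.
Qed.

Lemma is_diff_on_line (H : X -> C) (z v : X) (t : C) : holomorphic H ->
  is_diff t (fun s : C => H (z + s *: v)) (fun s : C => 'd H (z + t *: v) (s *: v)).
Proof.
move=> hH; exact: (is_diff_comp (is_diff_line z v t) (differentiableP (hH _))).
Qed.

Variables (H : X -> C) (z : X) (r B : R).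
Hypotheses (hH : holomorphic H) (r0 : 0 < r)
  (hB : forall w, nm (w - z) <= r -> nm (H w) <= B).

Let g v (s : C) : C := H (z + s *: v).

Let g_holo v : holomorphic (g v).
Proof. by move=> t; apply: (@ex_diff _ _ _ _ _ _ _ (is_diff_on_line z v t hH)). Qed.

Let g_diff v (t : C) : 'd (g v) 0 t = 'd H z (t *: v).
Proof. by rewrite (@diff_val _ _ _ _ _ _ _ (is_diff_on_line z v 0 hH)) scale0r addr0. Qed.

Let g_bound v (u : C) : v != 0 -> nm u = r / nm v -> nm (g v u) <= B.
Proof.
move=> v0 hu; apply: hB; rewrite addrC addKr nmZ hu divfK//.
by rewrite gt_eqF// nm_gt0.
Qed.

(** The function [H (z + s *: v)] of [s] is bounded by [B] on the circle of radius [r / nm v]; the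
    one-variable estimate is taken at [h = 1]. *)
Lemma directional_cauchy (v : X) : nm ('d H z v) <= B / r * nm v.
Proof.
have [->|v0] := eqVneq v 0; first by rewrite linear0 !nm0 mulr0.
have nv : 0 < nm v by rewrite nm_gt0.
have := cauchy_estimate (@g_holo v) (divr_gt0 r0 nv) (fun u => @g_bound v u v0) 1.
by rewrite g_diff scale1r nm1 mulr1 invf_div mulrA mulrAC.
Qed.

Lemma directional_cauchy2 (v : X) : nm v <= r / 2 ->
  nm (H (z + v) - H z - 'd H z v) <= 2 * B / r ^+ 2 * nm v ^+ 2.
Proof.
have [->|v0] := eqVneq v 0.
  by rewrite linear0 addr0 subrr subr0 !nm0 expr0n /= mulr0.
have nv : 0 < nm v by rewrite nm_gt0.
move=> hv.
have := cauchy_estimate2 (@g_holo v) (divr_gt0 r0 nv) (fun u => @g_bound v u v0) (h := 1).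
rewrite g_diff /g !scale1r scale0r addr0 nm1 expr1n mulr1 => hh.
apply: le_trans (hh _) _.
  by rewrite mulrAC ler_pdivlMr// mul1r.
by rewrite expr_div_n invf_div mulrA mulrAC.
Qed.

End DirectionalEstimates.

Lemma compact_nm_bounded {R : realType} {X : normedModType R[i]} (K : set X) :
  compact K -> exists B : R, forall z, K z -> nm z <= B.
Proof.
move=> /compact_near_coveringP cK.
have /cK : forall x, K x -> \forall x' \near x & B \near +oo%R, nm x' <= B.
  move=> x _; exists ([set x' | nm (x' - x) < 1], [set B : R | nm x + 1 <= B]) => /=.
    split; first by apply/nbhs_nmP; exists 1.
    by apply: nbhs_pinfty_ge; exact: num_real.
  move=> [x' B] /= [hx hB]; rewrite (le_trans _ hB)//.
  have -> : x' = x + (x' - x) by rewrite addrC subrK.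
  by rewrite (le_trans (nmD _ _))// lerD2l ltW.
by move=> /filter_ex [B hB]; exists B.
Qed.

(** * Polynomial approximation in several variables *)

(** An abstract linear coordinate system, so that the arguments in several variables treat position
    and momentum coordinates alike. The last field expresses local compactness: polydiscs lie in
    compact sets. *)
Record coordinates {R : realType} (X : normedModType R[i]) (I : finType) := Coordinates {
  coordinate : I -> X -> Cplx R;
  coord_dir : I -> X;
  coordinateD : forall i z w, coordinate i (z + w) = coordinate i z + coordinate i w;
  coordinateZ : forall i a z, coordinate i (a *: z) = a * coordinate i z;
  coordinate_dir : forall i j, coordinate i (coord_dir j) = (i == j)%:R;
  coordinate_inj : forall z w, (forall i, coordinate i z = coordinate i w) -> z = w;
  nm_coordinate_le : forall i z, nm (coordinate i z) <= nm z;
  nm_coord_dir_le : forall i, nm (coord_dir i) <= 1;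
  coordinate_compact : forall r : R, exists2 K : set X, compact K &
    [set z | forall i, nm (coordinate i z) <= r] `<=` K
}.

Section Coordinates.
Context {R : realType} {X : normedModType R[i]} {I : finType} (cs : coordinates X I).
Local Notation C := (Cplx R).
Local Notation zc := (coordinate cs).
Local Notation ddz := (coord_dir cs).

Lemma coordinate0 i : zc i 0 = 0.
Proof. by rewrite -(scale0r 0) coordinateZ mul0r. Qed.

Lemma coordinateB i (z w : X) : zc i (z - w) = zc i z - zc i w.
Proof. by rewrite -scaleN1r coordinateD coordinateZ mulN1r. Qed.

Lemma coordinate_sum i (J : Type) (s : seq J) (F : J -> X) :
  zc i (\sum_(j <- s) F j) = \sum_(j <- s) zc i (F j).
Proof.
elim: s => [|j s ih]; first by rewrite !big_nil coordinate0.
by rewrite !big_cons coordinateD ih.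
Qed.

Lemma coordinate_decomp (z : X) : z = \sum_i zc i z *: ddz i.
Proof.
apply: (@coordinate_inj _ _ _ cs) => i; rewrite coordinate_sum.
under eq_bigr do rewrite coordinateZ coordinate_dir.
rewrite (bigD1_seq i) ?mem_index_enum ?index_enum_uniq//= eqxx mulr1.
by rewrite big1 ?addr0// => j /negPf; rewrite eq_sym => ->; rewrite mulr0.
Qed.

Lemma is_diff_coordinate i (z : X) : is_diff z (zc i) (zc i).
Proof.
apply: (is_diff_of_bound (M := 1)).
- by move=> a x y; rewrite coordinateD coordinateZ.
- by move=> h; rewrite mul1r nm_coordinate_le.
- move=> e e0; exists 1 => // h _.
  by rewrite coordinateD [zc i z + _]addrC addrK subrr nm0 mulr_ge0 ?nm_ge0// ltW.
Qed.

Definition polydisc (r : R) : set X := [set z | forall i, nm (zc i z) <= r].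

Lemma ball_polydisc (z w : X) r : nm (w - z) <= r -> polydisc (nm z + r) w.
Proof.
move=> h i; rewrite (le_trans (nm_coordinate_le cs _ _))//.
have -> : w = z + (w - z) by rewrite addrC subrK.
by rewrite (le_trans (nmD _ _))// lerD2l.
Qed.

Lemma polydisc_bounded (Y : normedModType R[i]) (f : X -> Y) r : continuous f ->
  exists2 B : R, 0 <= B & forall z, polydisc r z -> nm (f z) <= B.
Proof.
move=> cf; have [K cK hK] := coordinate_compact cs r.
have [B hB] : exists B : R, forall y, (f @` K) y -> nm y <= B.
  apply: compact_nm_bounded; apply: continuous_compact cK.
  exact: continuous_subspaceT.
exists `|B| => // z /hK Kz; rewrite (le_trans (hB (f z) _)) ?ler_norm//.
Qed.

Definition monomial (a : {ffun I -> nat}) (z : X) : C := \prod_i zc i z ^+ a i.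

Inductive polynomial_fun : (X -> C) -> Prop :=
| Polynomial0 : polynomial_fun (fun=> 0)
| PolynomialAdd (c : C) a (f : X -> C) : polynomial_fun f ->
    polynomial_fun (fun z => c * monomial a z + f z).

Lemma polynomial_funD f g : polynomial_fun f -> polynomial_fun g ->
  polynomial_fun (fun z => f z + g z).
Proof.
move=> pf pg; elim: pf => [|c a h ph ih].
  by under eq_fun do rewrite add0r.
by under eq_fun do rewrite -addrA; exact: PolynomialAdd.
Qed.

Lemma polynomial_fun_ext f g : f =1 g -> polynomial_fun f -> polynomial_fun g.
Proof. by move=> /funext ->. Qed.

Lemma polynomial_funZ c f : polynomial_fun f -> polynomial_fun (fun z => c * f z).
Proof.
elim=> [|d a h ph ih].
  by under eq_fun do rewrite mulr0; exact: Polynomial0.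
by under eq_fun do rewrite mulrDr mulrA; exact: PolynomialAdd.
Qed.

Lemma polynomial_fun_monomial a : polynomial_fun (monomial a).
Proof.
apply: polynomial_fun_ext (PolynomialAdd 1 a Polynomial0) => z.
by rewrite mul1r addr0.
Qed.

Lemma polynomial_fun_sum (J : Type) (s : seq J) (F : J -> X -> C) :
  (forall j, polynomial_fun (F j)) -> polynomial_fun (fun z => \sum_(j <- s) F j z).
Proof.
move=> hF; elim: s => [|j s ih].
  by under eq_fun do rewrite big_nil; exact: Polynomial0.
by under eq_fun do rewrite big_cons; exact: polynomial_funD.
Qed.

Definition incr_exp (i : I) (a : {ffun I -> nat}) : {ffun I -> nat} :=
  [ffun j => (a j + (j == i))%N].

Lemma monomial_incr i a z : monomial (incr_exp i a) z = zc i z * monomial a z.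
Proof.
rewrite /monomial (bigD1 i) //= [in RHS](bigD1 i) //= ffunE eqxx addn1 exprS -mulrA.
congr (_ * (_ * _)); apply: eq_bigr => j /negPf ji.
by rewrite ffunE ji addn0.
Qed.

Lemma monomial0 z : monomial [ffun=> 0%N] z = 1.
Proof. by rewrite /monomial big1// => i _; rewrite ffunE expr0. Qed.

Lemma polynomial_fun_cst c : polynomial_fun (fun=> c).
Proof.
apply: polynomial_fun_ext (polynomial_funZ c (polynomial_fun_monomial [ffun=> 0%N])) => z.
by rewrite monomial0 mulr1.
Qed.

Lemma polynomial_fun_coordinateM i f : polynomial_fun f ->
  polynomial_fun (fun z => zc i z * f z).
Proof.
elim=> [|c a h ph ih].
  by under eq_fun do rewrite mulr0; exact: Polynomial0.
apply: polynomial_fun_ext (PolynomialAdd c (incr_exp i a) ih) => z.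
by rewrite monomial_incr mulrDr; congr (_ + _); rewrite mulrCA.
Qed.

Lemma polynomial_fun_coordinateXM i k f : polynomial_fun f ->
  polynomial_fun (fun z => zc i z ^+ k * f z).
Proof.
move=> pf; elim: k => [|k ih].
  by under eq_fun do rewrite expr0 mul1r.
by under eq_fun do rewrite exprS -mulrA; exact: polynomial_fun_coordinateM.
Qed.

End Coordinates.

Section PolynomialDensity.
Context {R : realType} {X : normedModType R[i]} {I : finType} (cs : coordinates X I).
Local Notation C := (Cplx R).
Local Notation zc := (coordinate cs).
Local Notation ddz := (coord_dir cs).
Local Notation polydisc := (polydisc cs).
Local Notation polynomial_fun := (polynomial_fun cs).
Implicit Types (z : X) (w : C).

Definition set_coordinate (i : I) w z : X := z + (w - zc i z) *: ddz i.

Lemma coordinate_set_coordinate i w z j :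
  zc j (set_coordinate i w z) = if j == i then w else zc j z.
Proof.
rewrite coordinateD coordinateZ coordinate_dir; case: eqVneq => [->|_].
  by rewrite mulr1 addrC subrK.
by rewrite mulr0 addr0.
Qed.

Lemma set_coordinate_same i z : set_coordinate i (zc i z) z = z.
Proof. by rewrite /set_coordinate subrr scale0r addr0. Qed.

Lemma set_coordinate_add i w z j (c : C) :
  set_coordinate i w (z + c *: ddz j) =
  if j == i then set_coordinate i w z else set_coordinate i w z + c *: ddz j.
Proof.
case: eqVneq => [->|ji]; apply: (@coordinate_inj _ _ _ cs) => k.
  by rewrite !coordinate_set_coordinate coordinateD coordinateZ coordinate_dir; case: eqP => // _; rewrite mulr0 addr0.
rewrite [RHS]coordinateD !coordinate_set_coordinate coordinateD coordinateZ coordinate_dir; case: eqVneq => [->|_]; [|by []].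
by rewrite eq_sym (negPf ji) mulr0 addr0.
Qed.

Lemma set_coordinate_sub i w w' z : set_coordinate i w' z - set_coordinate i w z = (w' - w) *: ddz i.
Proof.
by apply: (@coordinate_inj _ _ _ cs) => k; rewrite coordinateB coordinateZ !coordinate_set_coordinate coordinate_dir;
   case: eqP => _; rewrite ?mulr1 ?mulr0 ?subrr.
Qed.

Lemma is_diff_set_coordinate i w z :
  is_diff z (set_coordinate i w) (fun h => h - zc i h *: ddz i).
Proof.
apply: (is_diff_of_bound (M := 2)).
- move=> a x y; rewrite coordinateD coordinateZ scalerDl scalerBr scalerA opprD addrACA //.
- move=> h; rewrite (le_trans (nmB _ _))// mulr_natl mulr2n lerD2l nmZ.
  by rewrite -[leRHS]mulr1 ler_pM ?nm_ge0 ?nm_coordinate_le ?nm_coord_dir_le.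
- move=> e e0; exists 1 => // h _.
  suff -> : set_coordinate i w (z + h) - set_coordinate i w z - (h - zc i h *: ddz i) = 0.
    by rewrite nm0 mulr_ge0 ?nm_ge0// ltW.
  apply: (@coordinate_inj _ _ _ cs) => j; rewrite !coordinateB !coordinate_set_coordinate coordinateD coordinateZ coordinate_dir coordinate0.
  by case: eqP => [->|_]; rewrite ?mulr1 ?mulr0; ring.
Qed.

Lemma holomorphic_set_coordinate (f : X -> C) i w : holomorphic f ->
  holomorphic (fun z => f (set_coordinate i w z)).
Proof.
move=> hf z.
exact: (@ex_diff _ _ _ _ _ _ _
  (is_diff_comp (is_diff_set_coordinate i w z) (differentiableP (hf _)))).
Qed.

Lemma holomorphic_slice (f : X -> C) i z : holomorphic f ->
  holomorphic (fun w => f (set_coordinate i w z)).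
Proof.
move=> hf w.
have -> : (fun w => f (set_coordinate i w z)) =
    (fun w => f ((z - zc i z *: ddz i) + w *: ddz i)).
  apply/funext => w'; congr f; rewrite /set_coordinate scalerBl addrA.
  by rewrite addrAC.
exact: (@ex_diff _ _ _ _ _ _ _ (is_diff_on_line _ _ w hf)).
Qed.

Lemma slice_equicontinuous (f : X -> C) i rho : holomorphic f ->
  equicontinuous_on_discs [set g | exists2 z, polydisc rho z & g = fun w => f (set_coordinate i w z)].
Proof.
move=> hf r e e0.
have [K cK hK] := @coordinate_compact _ _ _ cs (Num.max rho r).
have [d d0 hd] := compact_unif_cont cK (holomorphic_continuous hf) e0.
exists d => // g [z hz ->] u v hu huv; apply: hd.
  apply: hK => j; rewrite coordinate_set_coordinate le_max; case: eqP => _.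
    by rewrite hu orbT.
  by rewrite hz.
rewrite set_coordinate_sub nmZ (le_trans _ huv)// ler_piMr ?nm_ge0 ?nm_coord_dir_le//.
Qed.

(** Induction on a list [s] of coordinates outside of which [f] does not vary. Interpolation in [i]
    writes [f] approximately as a sum of powers of that coordinate with coefficients built from
    [f (set_coordinate i (w l) z)], which no longer depend on it. *)
Lemma polynomial_dense_aux (s : seq I) (f : X -> C) : holomorphic f ->
  (forall i, i \notin s -> forall z (c : C), f (z + c *: ddz i) = f z) ->
  forall rho e : R, 0 < rho -> 0 < e -> exists P, polynomial_fun P /\
    forall z, polydisc rho z -> nm (P z - f z) <= e.
Proof.
elim: s f => [|i s ih] f hf indep rho e rho0 e0.
  exists (fun=> f 0); split; first exact: polynomial_fun_cst.
  move=> z _; suff -> : f z = f 0 by rewrite subrr nm0 ltW.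
  rewrite (coordinate_decomp cs z); elim: (index_enum _) => [|j t iht]; first by rewrite big_nil.
  by rewrite big_cons addrC indep.
(* Interpolation converges on the half disc only, so the nodes lie on the circle of twice the
   radius. *)
have r0 : 0 < 2 * rho by rewrite mulr_gt0.
have e20 : 0 < e / 2 by rewrite divr_gt0.
have [|N [om [N1 prim om1 hN]]] := interp_cvg _ (@slice_equicontinuous f i rho hf) r0 e20.
  by move=> g [z _ ->]; exact: holomorphic_slice.
pose w l : C := rc (2 * rho) * om ^+ l.
have nw l : nm (w l) = 2 * rho by rewrite /w nmM nmX om1 expr1n mulr1 nm_rc gtr0_norm.
(* The kernel, of norm at most 2, doubles the error made on the coefficients. *)
have e40 : 0 < e / 4 by rewrite divr_gt0.
have /choice [P hP] : forall l : nat, exists P, polynomial_fun P /\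
    forall z, polydisc rho z -> nm (P z - f (set_coordinate i (w l) z)) <= e / 4.
  move=> l; apply: ih => //; first exact: holomorphic_set_coordinate.
  move=> j js z c; rewrite set_coordinate_add; case: eqVneq => // ji.
  by rewrite indep// inE (negPf ji) (negPf js).
exists (fun z => N%:R^-1 * \sum_(l < N) P l z * \sum_(k < N) (zc i z / w l) ^+ k); split.
  apply/polynomial_funZ/polynomial_fun_sum => l.
  under eq_fun do rewrite mulr_sumr.
  apply: polynomial_fun_sum => k.
  apply: polynomial_fun_ext (polynomial_fun_coordinateXM i k (polynomial_funZ ((w l)^-1 ^+ k) (hP l).1)) => z.
  by rewrite exprMn; ring.
move=> z hz.
have hzr : nm (zc i z) <= 2 * rho / 2 by rewrite mulrC mulKf// hz.
have := hN (fun w => f (set_coordinate i w z)) (zc i z) (ex_intro2 _ _ z hz erefl) hzr.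
rewrite set_coordinate_same => h.
set q := interp _ _ _ _ _ in h.
rewrite (le_trans (nm_sub_trans q _ _))// [e]splitr lerD//.
rewrite /q /interp -mulrBr -sumrB.
have hsum l : nm (\sum_(k < N) (zc i z / w l) ^+ k) <= 2.
  rewrite (le_trans (nm_sum _ _ _))//; under eq_bigr do rewrite nmX.
  apply: geometric_sum_le; rewrite nm_ge0 nmM nmV nw ler_pdivrMr ?mulr_gt0//.
  by rewrite mulKf// hz.
under eq_bigr do rewrite -mulrBl.
apply: (nm_average N1 (g := fun l => (P l z - f (set_coordinate i (w l) z)) *
  \sum_(k < N) (zc i z / w l) ^+ k)) => l.
rewrite nmM (_ : e / 2 = e / 4 * 2); last by field.
by apply: ler_pM; rewrite ?nm_ge0 ?hsum ?(hP l).2.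
Qed.

Lemma polynomial_dense (f : X -> C) (rho e : R) : holomorphic f -> 0 < rho -> 0 < e ->
  exists P, polynomial_fun P /\ forall z, polydisc rho z -> nm (P z - f z) <= e.
Proof.
move=> hf; apply: (polynomial_dense_aux (s := enum {: I})) => // i.
by rewrite mem_enum.
Qed.

End PolynomialDensity.

(* Locked: unfolding ['d f z] makes unification diverge. *)
HB.lock Definition dirder {R : realType} {X Y : normedModType R[i]}
  (f : X -> Y) (z v : X) : Y := 'd f z v.

(** * Rules for directional derivatives *)

Section HolomorphicRules.
Context {R : realType} {X : normedModType R[i]}.
Local Notation C := (Cplx R).
Implicit Types f g : X -> C.

Lemma dirderE {Y : normedModType R[i]} (f df : X -> Y) z v : is_diff z f df -> dirder f z v = df v.
Proof. by rewrite dirder.unlock; case=> _ ->. Qed.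

Lemma holomorphic_is_diff {Y : normedModType R[i]} (f : X -> Y) z : holomorphic f -> is_diff z f (dirder f z).
Proof.
move=> hf; rewrite (_ : dirder f z = 'd f z); first exact: differentiableP.
by apply/funext => v; rewrite dirder.unlock.
Qed.

Lemma is_diff_holomorphic {Y : normedModType R[i]} (f : X -> Y) (df : X -> X -> Y) :
  (forall z, is_diff z f (df z)) -> holomorphic f.
Proof. by move=> h z; exact: (@ex_diff _ _ _ _ _ _ _ (h z)). Qed.

Lemma is_diff_mul f g (df dg : X -> C) z : is_diff z f df -> is_diff z g dg ->
  is_diff z (fun u => f u * g u) (fun v => f z * dg v + g z * df v).
Proof. by move=> hf hg; exact: is_diffM. Qed.

Lemma is_diff_lin c f g (df dg : X -> C) z : is_diff z f df -> is_diff z g dg ->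
  is_diff z (fun u => c * f u + g u) (fun v => c * df v + dg v).
Proof. by move=> hf hg; exact: is_diffD (is_diffZ c hf) hg. Qed.

Lemma is_diff_const (c : C) (z : X) : is_diff z (fun=> c) (fun=> 0 : C).
Proof. exact: is_diff_cst. Qed.

Lemma holomorphicM f g : holomorphic f -> holomorphic g ->
  holomorphic (fun z => f z * g z).
Proof.
move=> hf hg; apply: is_diff_holomorphic => z.
exact: is_diff_mul (holomorphic_is_diff _ hf) (holomorphic_is_diff _ hg).
Qed.

Lemma holomorphic_lin c f g : holomorphic f -> holomorphic g ->
  holomorphic (fun z => c * f z + g z).
Proof.
move=> hf hg; apply: is_diff_holomorphic => z.
exact: is_diff_lin (holomorphic_is_diff _ hf) (holomorphic_is_diff _ hg).
Qed.

Lemma holomorphic_const (c : C) : holomorphic (fun _ : X => c).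
Proof. by apply: is_diff_holomorphic => z; exact: is_diff_const. Qed.

Lemma dirderM f g z v : holomorphic f -> holomorphic g ->
  dirder (fun u => f u * g u) z v = f z * dirder g z v + g z * dirder f z v.
Proof.
move=> hf hg.
exact: (dirderE v (is_diff_mul (holomorphic_is_diff z hf) (holomorphic_is_diff z hg))).
Qed.

Lemma dirder_linear_comb c f g z v : holomorphic f -> holomorphic g ->
  dirder (fun u => c * f u + g u) z v = c * dirder f z v + dirder g z v.
Proof.
move=> hf hg.
exact: (dirderE v (is_diff_lin c (holomorphic_is_diff z hf) (holomorphic_is_diff z hg))).
Qed.

Lemma dirder_cst {Y : normedModType R[i]} (y : Y) (z v : X) : dirder (fun=> y) z v = 0.
Proof. exact: (dirderE v (is_diff_cst y z)). Qed.

End HolomorphicRules.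

(** * Derivatives of polynomials *)

Section DerivativeHolomorphic.
Context {R : realType} {X : normedModType R[i]} {I : finType} (cs : coordinates X I).
Local Notation C := (Cplx R).
Local Notation zc := (coordinate cs).
Local Notation ddz := (coord_dir cs).
Local Notation polynomial_fun := (polynomial_fun cs).
Local Notation monomial := (monomial cs).
Implicit Types (f g : X -> C) (a : {ffun I -> nat}).

Lemma holomorphic_coordinate i : holomorphic (zc i).
Proof. by apply: is_diff_holomorphic => z; exact: is_diff_coordinate. Qed.

Lemma dirder_coordinate i z v : dirder (zc i) z v = zc i v.
Proof. exact: (dirderE v (is_diff_coordinate cs i z)). Qed.

Lemma dirder_coordinateM i g z v : holomorphic g ->
  dirder (fun u => zc i u * g u) z v = zc i v * g z + zc i z * dirder g z v.
Proof.
move=> hg; apply: etrans (dirderM z v (@holomorphic_coordinate i) hg) _.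
by rewrite dirder_coordinate addrC (mulrC (g z)).
Qed.

(** The subtraction is truncated: exponent 0 stays 0, and there the coefficient [(a i)%:R] of the
    derivative vanishes. *)
Definition decr_exp (i : I) (a : {ffun I -> nat}) : {ffun I -> nat} :=
  [ffun j => (a j - (j == i))%N].

Lemma decr_expK i a : (0 < a i)%N -> incr_exp i (decr_exp i a) = a.
Proof.
move=> ai; apply/ffunP => j; rewrite !ffunE.
by case: eqVneq => [->|_]; rewrite ?subn0 ?addn0// subnK.
Qed.

Lemma incr_expK i a : decr_exp i (incr_exp i a) = a.
Proof. by apply/ffunP => j; rewrite !ffunE addnK. Qed.

Lemma decr_incr_exp i j a : i != j -> decr_exp i (incr_exp j a) = incr_exp j (decr_exp i a).
Proof.
move=> ij; apply/ffunP => k; rewrite !ffunE.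
case: (eqVneq k i) => [->|_]; last by rewrite !subn0.
by rewrite (negPf ij) !addn0.
Qed.

Lemma exponent_ind (P : {ffun I -> nat} -> Prop) : P [ffun=> 0%N] ->
  (forall i a, P a -> P (incr_exp i a)) -> forall a, P a.
Proof.
move=> h0 hS a; have [m] := ubnP (\sum_i a i); elim: m a => // m ih a.
have [/existsP [i ai]|] := boolP [exists i, (0 < a i)%N]; last first.
  move=> /existsPn ha _; suff -> : a = [ffun=> 0%N] by [].
  by apply/ffunP => i; rewrite ffunE; apply/eqP; rewrite -leqn0 leqNgt ha.
rewrite ltnS => ham; rewrite -(decr_expK ai); apply/hS/ih.
apply: leq_trans ham; rewrite (bigD1 i) //= [in X in (_ < X)%N](bigD1 i) //=.
rewrite ffunE eqxx subn1 -[X in (_ < X + _)%N](prednK ai) addSn ltnS leq_add2l.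
by apply: leq_sum => j /negPf ji; rewrite ffunE ji subn0.
Qed.

Lemma polynomial_ind (P : (X -> C) -> Prop) :
  (forall c, P (fun=> c)) -> (forall i f, polynomial_fun f -> P f -> P (fun z => zc i z * f z)) ->
  (forall c f g, polynomial_fun f -> polynomial_fun g -> P f -> P g -> P (fun z => c * f z + g z)) ->
  forall f, polynomial_fun f -> P f.
Proof.
move=> hc hM hL f; elim=> [|c a g pg ih]; first exact: hc.
apply: hL => //; first exact: polynomial_fun_monomial.
elim/exponent_ind: a => [|i a iha].
  by rewrite (_ : monomial _ = fun=> 1)//; apply/funext => z; rewrite monomial0.
rewrite (_ : monomial _ = fun z => zc i z * monomial a z).
  by apply: hM => //; exact: polynomial_fun_monomial.
by apply/funext => z; rewrite monomial_incr.
Qed.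

Lemma polynomial_holomorphic f : polynomial_fun f -> holomorphic f.
Proof.
elim/polynomial_ind => [c|i g _ hg|c g h _ _ hg hh].
- exact: holomorphic_const.
- exact: holomorphicM (holomorphic_coordinate i) hg.
- exact: holomorphic_lin.
Qed.

Lemma polynomial_dirder f u : polynomial_fun f -> polynomial_fun (fun z => dirder f z u).
Proof.
elim/polynomial_ind => [c|i g pg hg|c g h pg ph hg hh].
- apply: polynomial_fun_ext (Polynomial0 cs) => z; exact/esym/dirder_cst.
- apply: (@polynomial_fun_ext _ _ _ _ (fun z => zc i u * g z + zc i z * dirder g z u)).
    by move=> z; exact/esym/dirder_coordinateM/polynomial_holomorphic.
  by apply: polynomial_funD; [exact: polynomial_funZ|exact: polynomial_fun_coordinateM].
- apply: (@polynomial_fun_ext _ _ _ _ (fun z => c * dirder g z u + dirder h z u)).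
    by move=> z; apply/esym/dirder_linear_comb; exact: polynomial_holomorphic.
  by apply: polynomial_funD => //; exact: polynomial_funZ.
Qed.

Lemma polynomial_dirder_sym f z u v : polynomial_fun f ->
  dirder (fun z => dirder f z u) z v = dirder (fun z => dirder f z v) z u.
Proof.
move=> pf; elim/polynomial_ind: f / pf => [c|i g pg hg|c g h pg ph hg hh].
- have e w : (fun z => dirder (fun=> c) z w) = (fun=> 0) :> (X -> C).
    by apply/funext => z'; exact: dirder_cst.
  by rewrite !e; apply: etrans (dirder_cst _ _ _) (esym (dirder_cst _ _ _)).
- have hG := polynomial_holomorphic pg.
  have hdG w := polynomial_holomorphic (polynomial_dirder w pg).
  have e w : (fun z => dirder (fun z' => zc i z' * g z') z w) =
      (fun z => zc i w * g z + zc i z * dirder g z w).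
    by apply/funext => z'; exact: dirder_coordinateM.
  have E w w' : dirder (fun z => zc i w * g z + zc i z * dirder g z w) z w' =
     zc i w * dirder g z w' + (zc i w' * dirder g z w + zc i z * dirder (fun z => dirder g z w) z w').
    have hz := @holomorphic_coordinate i.
    apply: etrans (dirder_linear_comb _ z w' hG (holomorphicM hz (hdG w))) _.
    by congr (_ + _); exact: dirder_coordinateM (hdG w).
  by rewrite !e !E hg; ring.
- have hG := polynomial_holomorphic pg; have hH := polynomial_holomorphic ph.
  have hdG w := polynomial_holomorphic (polynomial_dirder w pg).
  have hdH w := polynomial_holomorphic (polynomial_dirder w ph).
  have e w : (fun z => dirder (fun z' => c * g z' + h z') z w) =
      (fun z => c * dirder g z w + dirder h z w).
    by apply/funext => z'; exact: dirder_linear_comb.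
  have E w w' := dirder_linear_comb c z w' (hdG w) (hdH w).
  by rewrite !e !E hg hh.
Qed.

Lemma dirder_monomial a i z : dirder (monomial a) z (ddz i) = (a i)%:R * monomial (decr_exp i a) z.
Proof.
elim/exponent_ind: a => [|j a ih].
  rewrite (_ : monomial _ = fun=> 1); last by apply/funext => z'; rewrite monomial0.
  by rewrite ffunE mul0r; exact: dirder_cst.
rewrite (_ : monomial _ = fun z => zc j z * monomial a z); last first.
  by apply/funext => z'; rewrite monomial_incr.
have hm := polynomial_holomorphic (polynomial_fun_monomial cs a).
apply: etrans (dirder_coordinateM j z (ddz i) hm) _.
rewrite coordinate_dir ih ffunE [j == i]eq_sym; case: (eqVneq i j) => [->|ji]; last first.
  by rewrite addn0 mulr0n mul0r add0r decr_incr_exp// monomial_incr mulrCA.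
rewrite addn1 incr_expK mul1r -natr1 mulrDl mul1r addrC; congr (_ + _).
have [->|a0] := posnP (a j); first by rewrite !mul0r mulr0.
by rewrite mulrCA -monomial_incr decr_expK.
Qed.

End DerivativeHolomorphic.

(** * Holomorphy of derivatives and symmetry of second derivatives *)

Section SecondDerivative.
Context {R : realType} {X : normedModType R[i]}.
Local Notation C := (Cplx R).

Lemma dirder_lin {Y : normedModType R[i]} (f : X -> Y) z (a : R[i]) u v :
  dirder f z (a *: u + v) = a *: dirder f z u + dirder f z v.
Proof. by rewrite dirder.unlock linearP. Qed.

Lemma dirderD {Y : normedModType R[i]} (f : X -> Y) z u v :
  dirder f z (u + v) = dirder f z u + dirder f z v.
Proof. by rewrite dirder.unlock linearD. Qed.

Lemma dirderZ {Y : normedModType R[i]} (f : X -> Y) z (a : R[i]) u :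
  dirder f z (a *: u) = a *: dirder f z u.
Proof. by rewrite dirder.unlock linearZ. Qed.

Lemma dirder_le (H : X -> C) z (r B : R) v : holomorphic H -> 0 < r ->
  (forall w, nm (w - z) <= r -> nm (H w) <= B) -> nm (dirder H z v) <= B / r * nm v.
Proof. by move=> hH r0 hB; rewrite dirder.unlock; exact: directional_cauchy. Qed.

Lemma dirder_le2 (H : X -> C) z (r B : R) v : holomorphic H -> 0 < r ->
  (forall w, nm (w - z) <= r -> nm (H w) <= B) -> nm v <= r / 2 ->
  nm (H (z + v) - H z - dirder H z v) <= 2 * B / r ^+ 2 * nm v ^+ 2.
Proof. by move=> hH r0 hB hv; rewrite dirder.unlock; exact: directional_cauchy2. Qed.

Lemma holomorphicB (f g : X -> C) : holomorphic f -> holomorphic g ->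
  holomorphic (fun z => f z - g z).
Proof.
move=> hf hg; have -> : (fun z => f z - g z) = (fun z => (-1) * g z + f z).
  by apply/funext => z; rewrite mulN1r addrC.
exact: holomorphic_lin.
Qed.

Lemma dirderB (f g : X -> C) z v : holomorphic f -> holomorphic g ->
  dirder (fun z => f z - g z) z v = dirder f z v - dirder g z v.
Proof.
move=> hf hg; have -> : (fun z => f z - g z) = (fun z => (-1) * g z + f z).
  by apply/funext => z'; rewrite mulN1r addrC.
by rewrite dirder_linear_comb// mulN1r addrC.
Qed.

Lemma tends_toB (u v : nat -> C) l l' : tends_to u l -> tends_to v l' ->
  tends_to (fun n => u n - v n) (l - l').
Proof.
move=> hu hv; rewrite -mulN1r.
apply: tends_to_ext (tends_toD hu (tends_toZ (-1) hv)) => n.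
by rewrite mulN1r.
Qed.

Lemma tends_to_geometric (u : nat -> C) l (c : R) :
  (forall k, nm (u k - l) <= c * 2^-1 ^+ k) -> tends_to u l.
Proof.
move=> h e e0; have [N hN] := exp2N_small c e0; exists N => k Nk.
rewrite (le_trans _ hN)// (le_trans (h k))//.
have c0 : 0 <= c.
  have := le_trans (nm_ge0 _) (h 0); by rewrite expr0 mulr1.
by rewrite ler_wpM2l// ler_wiXn2l// ?invr_ge0// invf_le1// ler1n.
Qed.

Context {I : finType} (cs : coordinates X I).

Section AtPoint.
Variables (H : X -> C) (z : X).
Hypothesis hH : holomorphic H.

(** Polynomials [P k] approximate [H] with error [2^-1 ^+ k]; by the Cauchy estimates their first
    and second derivatives converge. The limit [c] of the second derivatives inherits symmetry and
    linearity, and the second-order remainder bound, uniform in [k], passes to the limit and shows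
    that [c u] is the differential. *)
Let dirder_is_diff_at : exists c : X -> X -> C, (forall u v, c u v = c v u) /\
  forall u, is_diff z (fun w => dirder H w u) (c u).
Proof.
(* Derivatives are estimated at points within 3 of [z], by unit balls around them. *)
pose rho := nm z + 4.
have rho0 : 0 < rho by rewrite ltr_wpDl ?nm_ge0.
have h2 k : 0 < (2^-1 : R) ^+ k by rewrite exprn_gt0// invr_gt0.
have /choice [P hP] k := polynomial_dense cs hH rho0 (h2 k).
have hPh k := polynomial_holomorphic (hP k).1.
have [B B0 hB] := polydisc_bounded cs rho (holomorphic_continuous hH).
have in_disc w : nm (w - z) <= 4 -> polydisc cs rho w by exact: ball_polydisc.
have in_disc2 w w' : nm (w - z) <= 3 -> nm (w' - w) <= 1 -> polydisc cs rho w'.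
  move=> hw hw'; apply: in_disc; rewrite (le_trans (nm_sub_trans w _ _))//.
  by rewrite (_ : 4 = 1 + 3) ?lerD//; ring.
pose D k u w := dirder (P k) w u.
have hD k u : holomorphic (D k u) := polynomial_holomorphic (polynomial_dirder u (hP k).1).
have near k u w : nm (w - z) <= 3 -> nm (D k u w - dirder H w u) <= nm u * 2^-1 ^+ k.
  move=> hw; rewrite /D -dirderB// mulrC -[X in X * _]divr1.
  by apply: dirder_le => [|//|w' hw']; [exact: holomorphicB|exact: (hP k).2 (in_disc2 w w' hw hw')].
have bound k u w : nm (w - z) <= 3 -> nm (D k u w) <= (B + 1) * nm u.
  move=> hw; rewrite -[B + 1]divr1; apply: dirder_le => // w' hw'.
  have hd := in_disc2 w w' hw hw'.
  rewrite (_ : P k w' = H w' + (P k w' - H w')); last by rewrite addrC subrK.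
  rewrite (le_trans (nmD _ _))// lerD ?hB// (le_trans ((hP k).2 _ hd))//.
  by rewrite exprn_ile1// ?invr_ge0// invf_le1// ler1n.
have small w : nm (w - z) <= 1 -> nm (w - z) <= 3.
  by move=> h; rewrite (le_trans h)// ler1n.
have cauchy u v : exists l, tends_to (fun k => dirder (D k u) z v) l.
  apply: complex_cauchy_cvg => e e0.
  have [N hN] := exp2N_small (2 * (nm u * nm v)) e0.
  have hk k : (N <= k)%N -> nm u * 2^-1 ^+ k <= nm u * 2^-1 ^+ N.
    by move=> Nk; rewrite ler_wpM2l ?nm_ge0// ler_wiXn2l// ?invr_ge0// invf_le1// ler1n.
  exists N => k l Nk Nl; rewrite -dirderB//.
  have := @dirder_le (fun w => D k u w - D l u w) z 1 (2 * (nm u * 2^-1 ^+ N)) v.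
  move=> /(_ (holomorphicB (hD _ _) (hD _ _)) ltr01).
  have hle w : nm (w - z) <= 1 -> nm (D k u w - D l u w) <= 2 * (nm u * 2^-1 ^+ N).
    move=> /small hw; rewrite (le_trans (nm_sub_trans (dirder H w u) _ _))//.
    rewrite mulr_natl mulr2n lerD// ?(nm_distC (dirder H w u)).
      exact: le_trans (near k u w hw) (hk _ Nk).
    exact: le_trans (near l u w hw) (hk _ Nl).
  move=> /(_ hle) /le_trans; apply; rewrite divr1.
  by apply: le_trans hN; rewrite le_eqVlt; apply/orP; left; apply/eqP; ring.
have /choice [c hc] : forall uv : X * X, exists l,
    tends_to (fun k => dirder (D k uv.1) z uv.2) l by move=> [u v]; exact: cauchy.
exists (fun u v => c (u, v)); split.
  move=> u v; apply: tends_to_unique (hc (u, v)) _.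
  apply: tends_to_ext (hc (v, u)) => k /=.
  exact: polynomial_dirder_sym (hP k).1.
move=> u; apply: (is_diff_of_bound (M := (B + 1) * nm u)).
- move=> a v w; apply: tends_to_unique (hc (u, a *: v + w)) _.
  apply: tends_to_ext (tends_toD (tends_toZ a (hc (u, v))) (hc (u, w))) => k /=.
  by rewrite dirder_lin.
- move=> v; rewrite -[X in nm X]subr0; apply: (tends_to_le (N := 0%N) (hc (u, v))) => k _ /=.
  rewrite subr0 -[_ * nm u]divr1; apply: dirder_le => // w /small; exact: bound.
have hquad h : nm h <= 2^-1 -> nm (dirder H (z + h) u - dirder H z u - c (u, h)) <=
    2 * ((B + 1) * nm u) * nm h ^+ 2.
  move=> hh; rewrite -[X in nm X]subr0.
  have t w : nm (w - z) <= 3 -> tends_to (fun k => D k u w) (dirder H w u).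
    by move=> hw; apply: (@tends_to_geometric _ _ (nm u)) => k; exact: near.
  have zz : nm (z - z) <= 3 by rewrite subrr nm0.
  have zh : nm (z + h - z) <= 3.
    by rewrite addrC addKr; lra.
  apply: (tends_to_le (N := 0%N) (tends_toB (tends_toB (t _ zh) (t _ zz)) (hc (u, h)))) => k _.
  rewrite subr0 /=.
  have := @dirder_le2 (D k u) z 1 _ h (hD k u) ltr01 (fun w hw => bound k u w (small w hw)).
  by rewrite expr1n divr1 mul1r; apply.
move=> e e0.
pose Q := 2 * ((B + 1) * nm u) + 1.
have Q0 : 0 < Q by rewrite ltr_wpDl// !mulr_ge0 ?nm_ge0// addr_ge0.
exists (Num.min 2^-1 (e / Q)); first by rewrite lt_min invr_gt0 ltr0n divr_gt0.
move=> h; rewrite le_min => /andP[h1 h2']; rewrite (le_trans (hquad h h1))//.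
rewrite expr2 mulrA ler_wpM2r ?nm_ge0//.
rewrite ler_pdivlMr// mulrC in h2'; apply: le_trans h2'.
by rewrite ler_wpM2r ?nm_ge0// lerDl.
Qed.

Lemma dirder_differentiable u : differentiable (fun w => dirder H w u) z.
Proof.
have [c [_ hc]] := dirder_is_diff_at.
exact: (@ex_diff _ _ _ _ _ _ _ (hc u)).
Qed.

Lemma dirder_sym u v :
  dirder (fun w => dirder H w u) z v = dirder (fun w => dirder H w v) z u.
Proof.
have [c [csym hc]] := dirder_is_diff_at.
by rewrite (dirderE v (hc u)) (dirderE u (hc v)).
Qed.

End AtPoint.

Lemma dirder_holomorphic (H : X -> C) u : holomorphic H ->
  holomorphic (fun z => dirder H z u).
Proof. by move=> hH z; exact: dirder_differentiable. Qed.

End SecondDerivative.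

Section LieOperations.
Context {R : realType} {X : normedModType R[i]}.

Lemma lie_bracketE (V W : X -> X) z :
  lie_bracket V W z = dirder W z (V z) - dirder V z (W z).
Proof. by rewrite dirder.unlock. Qed.

Lemma lie_derivativeE (V : X -> X) (w : form2 X) z u v : lie_derivative V w z u v =
  dirder (fun z' => w z' u v) z (V z) - w z (lie_bracket V (fun=> u) z) v
  - w z u (lie_bracket V (fun=> v) z).
Proof. by rewrite dirder.unlock. Qed.

End LieOperations.

(** * Hamiltonian and symplectic fields *)

Section Symplectic.
Context {R : realType} {X : normedModType R[i]} {n : nat}.
(* The index [(true, k)] stands for [x_k] and [(false, k)] for [y_k]. *)
Variable cs : coordinates X (bool * 'I_n)%type.
Local Notation C := (Cplx R).
Local Notation zc := (coordinate cs).
Local Notation ddz := (coord_dir cs).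
Implicit Types (z u v : X) (V W : X -> X).

Definition omega u v : C :=
  \sum_(k < n) (zc (true, k) u * zc (false, k) v - zc (true, k) v * zc (false, k) u).

Local Notation form := (fun _ : X => omega).

Lemma omega_anti u v : omega u v = - omega v u.
Proof. by rewrite /omega -sumrN; apply: eq_bigr => k _; ring. Qed.

Lemma omegaDl u u' v : omega (u + u') v = omega u v + omega u' v.
Proof.
by rewrite /omega -big_split; apply: eq_bigr => k _ /=; rewrite !coordinateD; ring.
Qed.

Lemma omegaZl a u v : omega (a *: u) v = a * omega u v.
Proof.
by rewrite /omega mulr_sumr; apply: eq_bigr => k _ /=; rewrite !coordinateZ; ring.
Qed.

Lemma omegaBl u u' v : omega (u - u') v = omega u v - omega u' v.
Proof. by rewrite -scaleN1r omegaDl omegaZl mulN1r. Qed.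

Lemma omegaDr u v v' : omega u (v + v') = omega u v + omega u v'.
Proof. by rewrite ![omega u _]omega_anti omegaDl opprD. Qed.

Lemma omegaZr u a v : omega u (a *: v) = a * omega u v.
Proof. by rewrite ![omega u _]omega_anti omegaZl mulrN. Qed.

Lemma omegaNl u v : omega (- u) v = - omega u v.
Proof. by rewrite -scaleN1r omegaZl mulN1r. Qed.

Lemma omegaNr u v : omega u (- v) = - omega u v.
Proof. by rewrite -scaleN1r omegaZr mulN1r. Qed.

Lemma nm_omega_le u v : nm (omega u v) <= 2 * n%:R * nm u * nm v.
Proof.
have hk (k : 'I_n) : nm (zc (true, k) u * zc (false, k) v - zc (true, k) v * zc (false, k) u)
    <= 2 * (nm u * nm v).
  rewrite (le_trans (nmB _ _))// !nmM mulr_natl mulr2n [nm (zc _ v) * nm (zc _ u)]mulrC.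
  by rewrite lerD// ler_pM ?nm_ge0 ?nm_coordinate_le.
rewrite (le_trans (nm_sum _ _ _))//.
apply: le_trans (ler_sum _ (fun k _ => hk k)) _.
by rewrite sumr_const card_ord -mulr_natl le_eqVlt; apply/orP; left; apply/eqP; ring.
Qed.

Lemma omega_dir_y k u : omega u (ddz (false, k)) = zc (true, k) u.
Proof.
rewrite /omega (bigD1 k) //= !coordinate_dir eqxx /= mulr1 mul0r subr0.
rewrite big1 ?addr0// => l /negPf lk; rewrite !coordinate_dir.
have -> : ((false, l) == (false, k) :> bool * 'I_n) = false by rewrite -pair_eqE /= lk.
by rewrite mulr0 mul0r subrr.
Qed.

Lemma omega_dir_x k u : omega u (ddz (true, k)) = - zc (false, k) u.
Proof.
rewrite /omega (bigD1 k) //= !coordinate_dir eqxx /= mulr0 mul1r sub0r.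
rewrite big1 ?addr0// => l /negPf lk; rewrite !coordinate_dir.
have -> : ((true, l) == (true, k) :> bool * 'I_n) = false by rewrite -pair_eqE /= lk.
by rewrite mulr0 mul0r subrr.
Qed.

Lemma lie_derivative_omega V z u v :
  lie_derivative V form z u v = omega (dirder V z u) v + omega u (dirder V z v).
Proof.
have hb x : lie_bracket V (fun=> x) z = - dirder V z x.
  by rewrite lie_bracketE (dirder_cst x z (V z)) add0r.
rewrite lie_derivativeE (hb u) (hb v) (dirder_cst (omega u v) z (V z)) add0r.
by rewrite omegaNl omegaNr !opprK.
Qed.

(** The form is constant, so only the derivative of [V] enters: the condition says that the 1-form
    [omega (V z) dz] is closed, in the very shape required by [exists_primitive]. *)
Lemma symplecticP V : symplectic_fields form V <->
  holomorphic V /\ forall z u v, omega (dirder V z u) v = omega (dirder V z v) u.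
Proof.
split=> [[hV h]|[hV h]]; split=> // z u v.
  have := h z u v; rewrite lie_derivative_omega => /eqP; rewrite addr_eq0 => /eqP ->.
  by rewrite omega_anti opprK.
by rewrite lie_derivative_omega (omega_anti u) h subrr.
Qed.

Lemma is_diff_sum (J : Type) (s : seq J) (F : J -> X -> C) (dF : J -> X -> C) z :
  (forall j, is_diff z (F j) (dF j)) ->
  is_diff z (fun u => \sum_(j <- s) F j u) (fun v => \sum_(j <- s) dF j v).
Proof.
move=> hF; elim: s => [|j s ih].
  have e0 (G : J -> X -> C) : (fun u => \sum_(j <- [::]) G j u) = (fun=> 0).
    by apply/funext => u; rewrite big_nil.
  by rewrite !e0; exact: is_diff_const.
have eS (G : J -> X -> C) : (fun u => \sum_(i <- j :: s) G i u) =
    (fun u => 1 * G j u + \sum_(i <- s) G i u).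
  by apply/funext => u; rewrite big_cons mul1r.
by rewrite !eS; exact: is_diff_lin.
Qed.

Lemma is_diff_component V i z : holomorphic V ->
  is_diff z (fun x => zc i (V x)) (fun v => zc i (dirder V z v)).
Proof.
move=> hV; exact: (is_diff_comp (holomorphic_is_diff z hV) (is_diff_coordinate cs i (V z))).
Qed.

Lemma dirder_component V i z v : holomorphic V ->
  dirder (fun x => zc i (V x)) z v = zc i (dirder V z v).
Proof. by move=> hV; exact: (dirderE v (is_diff_component i z hV)). Qed.

Lemma holomorphic_component V i : holomorphic V -> holomorphic (fun x => zc i (V x)).
Proof. by move=> hV; apply: is_diff_holomorphic => z; exact: is_diff_component. Qed.

Lemma is_diff_of_components V (L : X -> X) z :
  (forall i, is_diff z (fun x => zc i (V x)) (fun v => zc i (L v))) -> is_diff z V L.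
Proof.
move=> h.
have hs (s : seq (bool * 'I_n)) : is_diff z (fun x => \sum_(i <- s) zc i (V x) *: ddz i)
    (fun v => \sum_(i <- s) zc i (L v) *: ddz i).
  elim: s => [|i s ih].
    have e0 (G : X -> X) : (fun u => \sum_(i <- [::]) zc i (G u) *: ddz i) = cst 0.
      by apply/funext => u; rewrite big_nil.
    by rewrite !e0; exact: is_diff_cst.
  have hi : is_diff z (fun x => zc i (V x) *: ddz i) (fun v => zc i (L v) *: ddz i).
    have e : (fun x => zc i (V x) *: ddz i) =
        (fun s : C => 0 + s *: ddz i) \o (fun x => zc i (V x)).
      by apply/funext => x /=; rewrite add0r.
    by rewrite e; exact: (is_diff_comp (h i) (is_diff_line 0 (ddz i) _)).
  have eS (G : X -> X) : (fun u => \sum_(j <- i :: s) zc j (G u) *: ddz j) =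
      (fun u => zc i (G u) *: ddz i) + (fun u => \sum_(j <- s) zc j (G u) *: ddz j).
    by apply/funext => u; rewrite big_cons.
  by rewrite !eS; exact: is_diffD.
have e (G : X -> X) : (fun u => \sum_i zc i (G u) *: ddz i) = G.
  by apply/funext => x; rewrite -coordinate_decomp.
by have := hs (index_enum _); rewrite !e.
Qed.

Lemma holomorphic_of_components V :
  (forall i, holomorphic (fun x => zc i (V x))) -> holomorphic V.
Proof.
move=> h; pose L z v := \sum_i dirder (fun x => zc i (V x)) z v *: ddz i.
apply: (is_diff_holomorphic (df := L)) => z; apply: is_diff_of_components => i.
have -> : (fun v => zc i (L z v)) = dirder (fun x => zc i (V x)) z.
  apply/funext => v; rewrite /L coordinate_sum (bigD1_seq i) ?mem_index_enum ?index_enum_uniq//=.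
  rewrite coordinateZ coordinate_dir eqxx mulr1 big1 ?addr0// => j /negPf ji.
  by rewrite coordinateZ coordinate_dir eq_sym ji mulr0.
exact: holomorphic_is_diff.
Qed.

Lemma is_diff_omega V W z : holomorphic V -> holomorphic W ->
  is_diff z (fun x => omega (V x) (W x))
    (fun v => omega (dirder V z v) (W z) + omega (V z) (dirder W z v)).
Proof.
move=> hV hW.
have -> : (fun v => omega (dirder V z v) (W z) + omega (V z) (dirder W z v)) =
  (fun v => \sum_(k < n)
  ((- 1) * (zc (true, k) (W z) * zc (false, k) (dirder V z v) +
    zc (false, k) (V z) * zc (true, k) (dirder W z v)) +
  (zc (true, k) (V z) * zc (false, k) (dirder W z v) +
    zc (false, k) (W z) * zc (true, k) (dirder V z v)))).
  by apply/funext => v; rewrite /omega -big_split; apply: eq_bigr => k _ /=; ring.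
have -> : (fun x => omega (V x) (W x)) = (fun x => \sum_(k < n)
    ((- 1) * (zc (true, k) (W x) * zc (false, k) (V x)) +
     zc (true, k) (V x) * zc (false, k) (W x))).
  by apply/funext => v; rewrite /omega; apply: eq_bigr => k _ /=; ring.
apply: is_diff_sum => k.
have hv i := is_diff_component i z hV; have hw i := is_diff_component i z hW.
exact: (is_diff_lin (-1) (is_diff_mul (hw (true, k)) (hv (false, k)))
  (is_diff_mul (hv (true, k)) (hw (false, k)))).
Qed.

End Symplectic.

Section HamiltonianFields.
Context {R : realType} {X : normedModType R[i]} {n : nat}.
Variable cs : coordinates X (bool * 'I_n)%type.
Local Notation C := (Cplx R).
Local Notation zc := (coordinate cs).
Local Notation ddz := (coord_dir cs).
Local Notation omega := (omega cs).
Local Notation form := (fun _ : X => omega).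
Implicit Types (z u v : X) (V W : X -> X) (H K : X -> C).

Lemma hamiltonian_functionP V H : hamiltonian_function form V H <->
  holomorphic H /\ forall z v, omega (V z) v = dirder H z v.
Proof. by rewrite dirder.unlock. Qed.

Lemma dirder_omegal V z u v : holomorphic V ->
  dirder (fun x => omega (V x) v) z u = omega (dirder V z u) v.
Proof.
move=> hV; have hv : holomorphic (fun _ : X => v).
  by apply: (is_diff_holomorphic (df := fun _ => 0)) => x; exact: is_diff_cst.
apply: etrans (dirderE u (is_diff_omega cs z hV hv)) _.
rewrite (dirder_cst v z u) (_ : omega (V z) 0 = 0) ?addr0//.
by rewrite -(scale0r v) omegaZr mul0r.
Qed.

(** Closedness of [dH] is the symmetry of the second derivatives of [H]. *)
Lemma hamiltonian_symplectic V : hamiltonian_fields form V -> symplectic_fields form V.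
Proof.
move=> [hV [H /hamiltonian_functionP [hH hVH]]]; apply/symplecticP; split=> // z u v.
rewrite -!dirder_omegal//.
have e x : (fun y => omega (V y) x) = (fun y => dirder H y x).
  by apply/funext => y; exact: hVH.
by rewrite !e; exact: (dirder_sym cs z hH).
Qed.

(** The domain is the whole space, so the primitive by integration from the origin is global. Its
    increment estimate and the continuity of [V] identify its differential. *)
Lemma symplectic_hamiltonian V : symplectic_fields form V -> hamiltonian_fields form V.
Proof.
move=> /symplecticP [hV symV]; split=> //.
pose M : R := 2 * n%:R.
have M0 : 0 <= M by rewrite mulr_ge0.
have [|H hH] := @exists_primitive R X X omega M (omegaBl cs) (omegaDr cs) (omegaZr cs)
  M0 (nm_omega_le cs) V hV _.
  by move=> z u v; have := symV z u v; rewrite dirder.unlock.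
have dH z : is_diff z H (omega (V z)).
  apply: (is_diff_of_bound (M := M * nm (V z))) => [a u v|h|e e0].
  - by rewrite omegaDr omegaZr.
  - exact: nm_omega_le.
  - have M1 : 0 < M + 1 by rewrite ltr_wpDl.
    have /continuous_nmP /(_ z _ (divr_gt0 e0 M1)) [d d0 hd] := holomorphic_continuous hV.
    exists (d / 2); first by rewrite divr_gt0.
    move=> h hh.
    have hzh : z + h - z = h by rewrite addrC addKr.
    have := hH z (z + h) (e / (M + 1)); rewrite hzh => hb; apply: le_trans (hb _) _.
      move=> x /line_nm; rewrite hzh => hx; apply: hd.
      by rewrite (le_lt_trans hx)// (le_lt_trans hh)// ltr_pdivrMr// ltr_pMr// ltr1n.
    rewrite ler_wpM2r ?nm_ge0// mulrA ler_pdivrMr// mulrC ler_wpM2l ?ltW//.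
    by rewrite ltrDl.
exists H; apply/hamiltonian_functionP; split; first exact: (is_diff_holomorphic dH).
by move=> z v; rewrite (dirderE v (dH z)).
Qed.

Lemma hamiltonian_eq_symplectic : hamiltonian_fields form = symplectic_fields form.
Proof.
apply/seteqP; split => V; [exact: hamiltonian_symplectic|exact: symplectic_hamiltonian].
Qed.

Lemma hamiltonian_function0 : hamiltonian_function form (fun=> 0) (fun=> 0).
Proof.
apply/hamiltonian_functionP; split; first exact: holomorphic_const.
by move=> z v; rewrite (dirder_cst 0 z v) -(scale0r z) omegaZl mul0r.
Qed.

Lemma hamiltonian_function_lin a V W H K :
  hamiltonian_function form V H -> hamiltonian_function form W K ->
  hamiltonian_function form (fun z => a *: V z + W z) (fun z => a * H z + K z).
Proof.
move=> /hamiltonian_functionP [hH hV] /hamiltonian_functionP [hK hW].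
apply/hamiltonian_functionP; split; first exact: holomorphic_lin.
by move=> z v; rewrite dirder_linear_comb// omegaDl omegaZl hV hW.
Qed.

Lemma holomorphic_field_lin a V W : holomorphic V -> holomorphic W ->
  holomorphic (fun z => a *: V z + W z).
Proof.
move=> hV hW; apply: (holomorphic_of_components (cs := cs)) => i.
have -> : (fun x => zc i (a *: V x + W x)) = (fun x => a * zc i (V x) + zc i (W x)).
  by apply/funext => x; rewrite coordinateD coordinateZ.
by apply: holomorphic_lin; exact: holomorphic_component.
Qed.

Lemma dirder_decomp H z v : dirder H z v = \sum_i zc i v * dirder H z (ddz i).
Proof.
rewrite {1}(coordinate_decomp cs v); elim: (index_enum _) => [|i s ih].
  by rewrite !big_nil -(scale0r 0) dirderZ scale0r.
by rewrite !big_cons dirderD dirderZ ih.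
Qed.

Lemma holomorphic_sum (J : Type) (s : seq J) (F : J -> X -> C) :
  (forall j, holomorphic (F j)) -> holomorphic (fun z => \sum_(j <- s) F j z).
Proof.
move=> hF; apply: is_diff_holomorphic => z; apply: is_diff_sum => j.
exact: holomorphic_is_diff.
Qed.

Lemma holomorphic_dirder_along H V : holomorphic H -> holomorphic V ->
  holomorphic (fun z => dirder H z (V z)).
Proof.
move=> hH hV.
have -> : (fun z => dirder H z (V z)) =
    (fun z => \sum_i zc i (V z) * dirder H z (ddz i)).
  by apply/funext => z; exact: dirder_decomp.
apply: holomorphic_sum => i; apply: holomorphicM; first exact: holomorphic_component.
exact: (dirder_holomorphic cs).
Qed.

Lemma holomorphic_lie_bracket V W : holomorphic V -> holomorphic W ->
  holomorphic (lie_bracket V W).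
Proof.
move=> hV hW; apply: (holomorphic_of_components (cs := cs)) => i.
have -> : (fun z => zc i (lie_bracket V W z)) =
  (fun z => dirder (fun x => zc i (W x)) z (V z) - dirder (fun x => zc i (V x)) z (W z)).
  apply/funext => z; rewrite lie_bracketE coordinateB.
  by rewrite (dirder_component cs i z (V z) hW) (dirder_component cs i z (W z) hV).
by apply: holomorphicB; apply: holomorphic_dirder_along => //; exact: holomorphic_component.
Qed.

(** The Hamiltonian is [- omega V W]. Differentiating it along [v] and moving [v] out of the
    derivatives by the symmetry of symplectic fields gives [omega (W' V - V' W) v]. *)
Lemma hamiltonian_function_bracket V W H K : holomorphic V -> holomorphic W ->
  hamiltonian_function form V H -> hamiltonian_function form W K ->
  hamiltonian_function form (lie_bracket V W) (fun z => - dirder H z (W z)).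
Proof.
move=> hV hW hVH hWK.
have /hamiltonian_functionP [hH eV] := hVH.
have /symplecticP [_ sV] : symplectic_fields form V.
  by apply: hamiltonian_symplectic; split=> //; exists H.
have /symplecticP [_ sW] : symplectic_fields form W.
  by apply: hamiltonian_symplectic; split=> //; exists K.
apply/hamiltonian_functionP; split.
  have := holomorphicB (@holomorphic_const _ X 0) (holomorphic_dirder_along hH hW).
  by under eq_fun do rewrite sub0r.
move=> z v.
have -> : (fun z => - dirder H z (W z)) = (fun z => (- 1) * omega (V z) (W z) + (fun _ : X => 0) z).
  by apply/funext => x; rewrite -eV mulN1r addr0.
have hO : holomorphic (fun z => omega (V z) (W z)).
  by apply: is_diff_holomorphic => x; exact: is_diff_omega.
rewrite (dirder_linear_comb (-1) z v hO (@holomorphic_const _ X 0)) (dirder_cst 0 z v) addr0.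
rewrite (dirderE v (is_diff_omega cs z hV hW)) lie_bracketE omegaBl (sW z (V z) v) (sV z (W z) v).
by rewrite [omega (V z) _]omega_anti; ring.
Qed.

Lemma hamiltonian_lie_subalgebra : lie_subalgebra (hamiltonian_fields form).
Proof.
split.
- split; last by exists (fun=> 0); exact: hamiltonian_function0.
  by apply: (is_diff_holomorphic (df := fun _ => 0)) => x; exact: is_diff_cst.
- move=> a V W [hV [H hH]] [hW [K hK]]; split; first exact: holomorphic_field_lin.
  by exists (fun z => a * H z + K z); exact: hamiltonian_function_lin.
- move=> V W [hV [H hH]] [hW [K hK]]; split; first exact: holomorphic_lie_bracket.
  by exists (fun z => - dirder H z (W z)); exact: hamiltonian_function_bracket hK.
Qed.

End HamiltonianFields.

(** * Generation of the polynomial Hamiltonian fields *)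

Section GeneratingFields.
Context {R : realType} {X : normedModType R[i]} {n : nat}.
Variable cs : coordinates X (bool * 'I_n)%type.
Local Notation C := (Cplx R).
Local Notation I := (bool * 'I_n)%type.
Local Notation zc := (coordinate cs).
Local Notation ddz := (coord_dir cs).
Local Notation omega := (omega cs).
Local Notation form := (fun _ : X => omega).
Local Notation monomial := (monomial cs).
Implicit Types (z u v : X) (V W : X -> X) (H K : X -> C) (a b c : {ffun I -> nat}).

Lemma omega_dirl i v : omega (ddz i) v = if i.1 then zc (false, i.2) v else - zc (true, i.2) v.
Proof.
by case: i => [[] k] /=; rewrite omega_anti; rewrite ?omega_dir_x ?omega_dir_y ?opprK.
Qed.

Definition conj_index (i : I) : I := (~~ i.1, i.2).

(** Hamilton's equations: the [x_k] component is the derivative of [H] in [y_k], and the [y_k]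
    component is minus its derivative in [x_k]. *)
Lemma hamiltonian_component V H i z : hamiltonian_function form V H ->
  zc i (V z) = (if i.1 then 1 else -1) * dirder H z (ddz (conj_index i)).
Proof.
move=> /hamiltonian_functionP [_ hV]; rewrite -hV.
case: i => [[] k]; rewrite /conj_index /=; first by rewrite omega_dir_y mul1r.
by rewrite omega_dir_x mulrNN mul1r.
Qed.

Lemma hamiltonian_function_holomorphic V H : hamiltonian_function form V H -> holomorphic V.
Proof.
move=> hVH; apply: (holomorphic_of_components (cs := cs)) => i.
have /hamiltonian_functionP [hH _] := hVH.
have -> : (fun z => zc i (V z)) =
    (fun z => (if i.1 then 1 else -1) * dirder H z (ddz (conj_index i)) + (fun _ : X => 0) z).
  by apply/funext => z; rewrite (hamiltonian_component _ _ hVH) addr0.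
apply: holomorphic_lin; last exact: holomorphic_const.
exact: (dirder_holomorphic cs).
Qed.

Lemma coordinateX_holomorphic i m : holomorphic (fun z => zc i z ^+ m).
Proof.
elim: m => [|m ih]; first by under eq_fun do rewrite expr0; exact: holomorphic_const.
under eq_fun do rewrite exprS.
by apply: holomorphicM => //; exact: holomorphic_coordinate.
Qed.

Lemma dirder_coordinateX i m z v :
  dirder (fun z => zc i z ^+ m.+1) z v = m.+1%:R * zc i z ^+ m * zc i v.
Proof.
elim: m => [|m ih].
  by under eq_fun do rewrite expr1; rewrite dirder_coordinate expr0; ring.
have -> : (fun z => zc i z ^+ m.+2) = (fun z => zc i z * zc i z ^+ m.+1).
  by apply/funext => x; rewrite exprS.
apply: etrans (dirder_coordinateM cs i z v (@coordinateX_holomorphic i m.+1)) _.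
by rewrite ih -[m.+2%:R]natr1 exprS; ring.
Qed.

Lemma hamiltonian_shear i p :
  hamiltonian_function form (fun z => zc i z ^+ p *: ddz (conj_index i))
    (fun z => (if i.1 then - (p.+1%:R)^-1 else (p.+1%:R)^-1) * zc i z ^+ p.+1).
Proof.
apply/hamiltonian_functionP.
have e (q : C) : (fun z => q * zc i z ^+ p.+1) = (fun z => q * zc i z ^+ p.+1 + (fun _ : X => 0) z).
  by apply/funext => z; rewrite addr0.
have h0 := @holomorphic_const _ X 0.
have hX := @coordinateX_holomorphic i p.+1.
rewrite e; split; first exact: holomorphic_lin.
move=> z v; rewrite (dirder_linear_comb _ z v hX h0) (dirder_cst 0 z v) addr0.
rewrite dirder_coordinateX omegaZl omega_dirl.
have p0 : (p.+1%:R : C) != 0 by rewrite pnatr_eq0.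
by case: i {e hX} => [[] k] /=; move: (p.+1%:R : C) p0 => q q0; field.
Qed.

Lemma hamiltonian_mixed s (j k : 'I_n) :
  hamiltonian_function form
    (fun z => zc (s, j) z *: ddz (~~ s, k) + zc (s, k) z *: ddz (~~ s, j))
    (fun z => (if s then -1 else 1) * (zc (s, j) z * zc (s, k) z)).
Proof.
apply/hamiltonian_functionP.
have e (q : C) : (fun z => q * (zc (s, j) z * zc (s, k) z)) =
    (fun z => q * (zc (s, j) z * zc (s, k) z) + (fun _ : X => 0) z).
  by apply/funext => z; rewrite addr0.
have h0 := @holomorphic_const _ X 0.
have hc i := @holomorphic_coordinate _ X _ cs i.
have hX := holomorphicM (hc (s, j)) (hc (s, k)).
rewrite e; split; first exact: holomorphic_lin.
move=> z v; rewrite (dirder_linear_comb _ z v hX h0) (dirder_cst 0 z v) addr0.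
rewrite (dirder_coordinateM cs (s, j) z v (hc (s, k))) dirder_coordinate.
by rewrite omegaDl !omegaZl !omega_dirl; case: s {e hX} => /=; ring.
Qed.

Lemma monomialD a b c z : (forall j, c j = (a j + b j)%N) ->
  monomial c z = monomial a z * monomial b z.
Proof.
move=> h; rewrite -big_split; apply: eq_bigr => i _ /=.
by rewrite h exprD.
Qed.

Definition single_exp (i : I) (p : nat) : {ffun I -> nat} := [ffun j => if j == i then p else 0%N].

Lemma monomial_single i p z : monomial (single_exp i p) z = zc i z ^+ p.
Proof.
rewrite /monomial (bigD1 i) //= ffunE eqxx big1 ?mulr1// => j /negPf ji.
by rewrite ffunE ji expr0.
Qed.

Variable L : set (X -> X).
Hypothesis L_lie : lie_subalgebra L.
Hypothesis L_shear : forall i p, L (fun z => zc i z ^+ p *: ddz (conj_index i)).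
Hypothesis L_mixed : forall j k : 'I_n, j != k ->
  L (fun z => zc (true, j) z *: ddz (false, k) + zc (true, k) z *: ddz (false, j)).

(** Passing from fields to Hamiltonians turns Lie brackets into Poisson brackets, up to sign.
    Constants belong to it through the zero field. *)
Definition generated_hamiltonian H : Prop := exists2 V, L V & hamiltonian_function form V H.
Local Notation S := generated_hamiltonian.

Lemma generated0 : S (fun=> 0).
Proof. by exists (fun=> 0); [case: L_lie|exact: hamiltonian_function0]. Qed.

Lemma generated_lin (q : C) H K : S H -> S K -> S (fun z => q * H z + K z).
Proof.
move=> [V LV hV] [W LW hW]; exists (fun z => q *: V z + W z).
  by case: L_lie => _ + _; apply.
exact: (hamiltonian_function_lin q hV hW).
Qed.

Lemma generated_scale (q : C) H : q != 0 -> S (fun z => q * H z) -> S H.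
Proof.
move=> q0 h; have := generated_lin q^-1 h generated0; rewrite (_ : (fun z => _) = H)//.
by apply/funext => z; rewrite addr0 mulKf.
Qed.

Lemma generated_poisson H W K : S H -> L W -> hamiltonian_function form W K ->
  S (fun z => dirder H z (W z)).
Proof.
move=> [V LV hV] LW hW; apply: (@generated_scale (-1)); first by rewrite oppr_eq0 oner_eq0.
exists (lie_bracket V W); first by case: L_lie => _ _; apply.
have -> : (fun z => (-1 : C) * dirder H z (W z)) = (fun z => - dirder H z (W z)).
  by apply/funext => z; rewrite mulN1r.
exact: (hamiltonian_function_bracket (hamiltonian_function_holomorphic hV)
  (hamiltonian_function_holomorphic hW) hV hW).
Qed.

(* The hypotheses say that a single term of the Poisson bracket survives. *)
Lemma generated_monomial_poisson a b c i : S (monomial a) -> S (monomial b) ->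
  (forall j, j != i -> (b (conj_index j) * a j = 0)%N) ->
  (0 < b (conj_index i) * a i)%N ->
  (forall j, c j = (decr_exp (conj_index i) b j + decr_exp i a j)%N) ->
  S (monomial c).
Proof.
move=> Sa [W LW hW] h0 hi hc.
pose s (j : I) : C := if j.1 then 1 else -1.
have s0 : s i != 0 by rewrite /s; case: i.1; rewrite ?oppr_eq0 oner_eq0.
apply: (@generated_scale (s i * (b (conj_index i) * a i)%:R)).
  by rewrite mulf_neq0// pnatr_eq0 -lt0n.
have := generated_poisson Sa LW hW; rewrite (_ : (fun z => dirder _ _ _) = (fun z =>
  s i * (b (conj_index i) * a i)%:R * monomial c z))//; apply/funext => z.
rewrite (dirder_decomp cs) (bigD1_seq i) ?mem_index_enum ?index_enum_uniq//= big1 ?addr0.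
  rewrite (hamiltonian_component _ _ hW) !dirder_monomial -/(s i) (monomialD z hc) natrM.
  ring.
move=> j ji; rewrite (hamiltonian_component _ _ hW) !dirder_monomial.
have /(congr1 (fun m => m%:R : C)) := h0 j ji; rewrite natrM mulr0n => e0.
apply: (@etrans _ _ (s j * ((b (conj_index j))%:R * (a j)%:R)
  * (monomial (decr_exp (conj_index j) b) z * monomial (decr_exp j a) z))).
  by rewrite -/(s j); ring.
by rewrite e0 mulr0 mul0r.
Qed.

Lemma generated_single i p : S (monomial (single_exp i p.+1)).
Proof.
pose q : C := if i.1 then - (p.+1%:R)^-1 else (p.+1%:R)^-1.
have q0 : q != 0 by rewrite /q; case: i.1; rewrite ?oppr_eq0 invr_eq0 pnatr_eq0.
apply: (generated_scale q0); exists (fun z => zc i z ^+ p *: ddz (conj_index i)) => //.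
have -> : (fun z => q * monomial (single_exp i p.+1) z) = (fun z => q * zc i z ^+ p.+1).
  by apply/funext => z; rewrite monomial_single.
exact: hamiltonian_shear.
Qed.

Lemma generated_mixed (j k : 'I_n) : j != k ->
  S (monomial (incr_exp (true, j) (single_exp (true, k) 1))).
Proof.
move=> jk; have q0 : (-1 : C) != 0 by rewrite oppr_eq0 oner_eq0.
apply: (generated_scale q0); exists (fun z => zc (true, j) z *: ddz (false, k) + zc (true, k) z *: ddz (false, j)).
  exact: L_mixed.
have -> : (fun z => (-1 : C) * monomial (incr_exp (true, j) (single_exp (true, k) 1)) z) =
    (fun z => (-1 : C) * (zc (true, j) z * zc (true, k) z)).
  by apply/funext => z; rewrite monomial_incr monomial_single expr1.
exact: (hamiltonian_mixed true j k).
Qed.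

Lemma generated_const (q : C) : S (fun=> q).
Proof.
exists (fun=> 0); first by case: L_lie.
apply/hamiltonian_functionP; split; first exact: holomorphic_const.
by move=> z v; rewrite (dirder_cst q z v) -(scale0r z) omegaZl mul0r.
Qed.

Definition pair_exp (i : 'I_n) (p q : nat) : {ffun I -> nat} :=
  [ffun j => if j.2 == i then if j.1 then p else q else 0%N].

Lemma generated_pair i p q : S (monomial (pair_exp i p q)).
Proof.
apply: (generated_monomial_poisson (i := (true, i)) (generated_single (true, i) p) (generated_single (false, i) q)).
- by move=> j /negPf ji; rewrite !ffunE ji muln0.
- by rewrite !ffunE !eqxx.
- move=> [s l]; rewrite !ffunE /conj_index !xpair_eqE /=.
  by case: s => /=; case: (l == i); rewrite /= ?subn0 ?subn1 ?addn0.
Qed.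

Definition supported_below (m : nat) a : Prop := forall i : I, (m <= i.2)%N -> a i = 0%N.

Lemma generated_supported_below m : (m <= n)%N -> forall a, supported_below m a -> S (monomial a).
Proof.
elim: m => [_ a ha|m ih mn a ha].
  have -> : monomial a = fun=> 1; last exact: generated_const.
  apply/funext => z; rewrite (_ : a = [ffun=> 0%N]) ?monomial0//.
  by apply/ffunP => i; rewrite ffunE ha.
pose i : 'I_n := Ordinal mn.
pose a' : {ffun I -> nat} := [ffun j => if j.2 == i then 0%N else a j].
have supp_a' : supported_below m a'.
  move=> j mj; rewrite ffunE; case: eqVneq => // ji; apply: ha.
  by rewrite ltn_neqAle mj andbT eq_sym; move: ji; rewrite -val_eqE.
(* The auxiliary index 0 must differ from the new index [i], whose value is [m]; when [m = 0] a
   single pair is involved and [generated_pair] applies. *)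
have [m0|m0] := posnP m.
  have -> : a = pair_exp i (a (true, i)) (a (false, i)); last exact: generated_pair.
  apply/ffunP => -[s l]; rewrite ffunE /=; case: eqVneq => [->|li]; first by case: s.
  by apply: ha => /=; rewrite m0 lt0n; move: li; rewrite -val_eqE /= m0.
pose k0 : 'I_n := Ordinal (leq_ltn_trans (leq0n m) mn).
have ik0 : i != k0 by rewrite -val_eqE /= -lt0n.
(* The monomial is first multiplied by [y_0]. The bracket with [x_0 x_i] removes this factor again,
   and its coefficient is nonzero even if [a'] contains no [y_0]. *)
have SA : S (monomial (incr_exp (true, i) a')).
  apply: (generated_monomial_poisson (i := (true, k0)) (generated_mixed ik0)).
  - apply: (ih (ltnW mn) (incr_exp (false, k0) a')) => -[s l] /= ml.
    rewrite ffunE supp_a'// xpair_eqE (_ : l == k0 = false) ?andbF//.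
    by apply/negP => /eqP lk; move: ml; rewrite lk leqNgt m0.
  - move=> [s l]; rewrite /conj_index !ffunE !xpair_eqE /=.
    case: s => /=; rewrite ?muln0//; case: (eqVneq l k0) => //= lk _.
    by case: (eqVneq l i) => _ /=; rewrite ?addn0 ?muln0 ?mul0n.
  - by rewrite /conj_index !ffunE !xpair_eqE /= ?eqxx /= addn1 muln_gt0.
  - move=> [s l]; rewrite /conj_index !ffunE !xpair_eqE /=.
    by case: s => /=; case: (l == k0); case: (l == i); rewrite /= ?addnK ?subn0 ?subn1 ?addn0 ?addn1.
(* Differentiation removes the auxiliary [x_i] from one factor and one power of [y_i] from the
   other, hence the successor exponent. The opposite term vanishes since [a'] involves no variable
   of index [i]. *)
apply: (generated_monomial_poisson (i := (true, i)) SA (generated_pair i (a (true, i)) (a (false, i)).+1)).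
- move=> [s l]; rewrite /conj_index !ffunE !xpair_eqE /=.
  by case: (eqVneq l i) => //= _; case: s => //= _; rewrite ?addn0 ?muln0.
- by rewrite /conj_index !ffunE !xpair_eqE /= !eqxx.
- move=> [s l]; rewrite /conj_index !ffunE !xpair_eqE /=.
  by case: (eqVneq l i) => /= [->|_]; case: s; rewrite /= ?addnK ?subn0 ?subn1 ?addn0 ?add0n.
Qed.

Lemma generated_polynomial H : polynomial_fun cs H -> S H.
Proof.
elim=> [|q a K pK SK]; first exact: generated0.
apply: (@generated_lin q (monomial a) K _ SK); apply: (generated_supported_below (leqnn n)) => i.
by rewrite leqNgt ltn_ord.
Qed.

End GeneratingFields.

(** * Density *)

Section Density.
Context {R : realType} {X : normedModType R[i]}.
Local Notation C := (Cplx R).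

Lemma lie_generated_subalgebra (G : set (X -> X)) : lie_subalgebra (lie_generated G).
Proof.
split.
- by move=> M [[h _ _] _].
- by move=> a V W hV hW M hM; have [[_ h _] _] := hM; apply: h; [exact: hV|exact: hW].
- by move=> V W hV hW M hM; have [[_ _ h] _] := hM; apply: h; [exact: hV|exact: hW].
Qed.

(** Approximants with error [2^-1 ^+ k] on the ball of radius [k.+1] form a sequence converging
    uniformly on compact sets, as these are bounded. *)
Lemma closure_of_approx (S : set (X -> X)) (V : X -> X) :
  (forall r e : R, 0 < r -> 0 < e ->
    exists2 W, S W & forall z, nm z <= r -> nm (W z - V z) <= e) ->
  closure (S : set {family compact, X -> X}) V.
Proof.
move=> h.
have h2 k : 0 < (2^-1 : R) ^+ k by rewrite exprn_gt0// invr_gt0.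
have /choice [W hW] : forall k : nat, exists W, S W /\
    forall z, nm z <= k.+1%:R -> nm (W z - V z) <= 2^-1 ^+ k.
  move=> k; have [W SW hW] := h k.+1%:R _ (ltr0Sn R k) (h2 k).
  by exists W.
have cvgW : {family compact, (W @ \oo) --> V}.
  apply/fam_cvgP => A cA P /uniform_nbhs [E [entE EP]].
  move: entE; rewrite -(@entourage_from_ballE _ X) => -[_ /= /posc_realP [e e0 ->] he].
  have [B hB] := compact_nm_bounded cA.
  have [N hN] := exp2N_small 2 e0.
  exists (maxn N (Num.truncn B)) => // k /=; rewrite geq_max => /andP[Nk Bk].
  apply: EP => y Ay; apply: he => /=; rewrite -ball_normE /= distrC nm_lt.
  have hy : nm y <= k.+1%:R.
    rewrite (le_trans (hB _ Ay))// (le_trans (ltW (truncnS_gt B)))// ler_nat ltnS//.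
  apply: (le_lt_trans ((hW k).2 y hy)).
  apply: (@le_lt_trans _ _ (2^-1 ^+ N)).
    by rewrite ler_wiXn2l// ?invr_ge0// invf_le1// ler1n.
  by apply: lt_le_trans hN; rewrite ltr_pMl// ltr1n.
move=> B nB; have [k _ hk] := cvgW _ nB.
by exists (W k); split; [exact: (hW k).1|exact: (hk k (leqnn k))].
Qed.

(** The flow is [z + t *: V z]: its orbits are straight complex lines run at constant velocity. *)
Lemma complete_of_constant_along (V : X -> X) :
  (forall z (t : C), V (z + t *: V z) = V z) -> complete_field V.
Proof.
move=> hV; exists (fun t z => z + t *: V z) => z; split.
  by rewrite scale0r addr0.
move=> t; rewrite hV; have hd := is_diff_line z (V z) t.
have df : differentiable (fun s : C => z + s *: V z) t := @ex_diff _ _ _ _ _ _ _ hd.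
apply: DeriveDef; first exact: diff_derivable.
by rewrite deriveE// (@diff_val _ _ _ _ _ _ _ hd) scale1r.
Qed.

Context {n : nat}.
Variable cs : coordinates X (bool * 'I_n)%type.
Local Notation I := (bool * 'I_n)%type.
Local Notation zc := (coordinate cs).
Local Notation ddz := (coord_dir cs).
Local Notation form := (fun _ : X => omega cs).

Lemma nm_le_sum_coordinates (u : X) (e : R) : (forall i, nm (zc i u) <= e) ->
  nm u <= #|{: I}|%:R * e.
Proof.
move=> h; rewrite (coordinate_decomp cs u) (le_trans (nm_sum _ _ _))//.
have -> : #|{: I}|%:R * e = \sum_(i : I) e by rewrite sumr_const mulr_natl.
apply: ler_sum => i _; rewrite nmZ -[e]mulr1.
by apply: ler_pM; rewrite ?nm_ge0 ?nm_coord_dir_le.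
Qed.

Lemma hamiltonian_field_approx (L : set (X -> X)) V (r e : R) : lie_subalgebra L ->
  (forall i p, L (fun z => zc i z ^+ p *: ddz (conj_index i))) ->
  (forall j k : 'I_n, j != k ->
    L (fun z => zc (true, j) z *: ddz (false, k) + zc (true, k) z *: ddz (false, j))) ->
  hamiltonian_fields form V -> 0 < r -> 0 < e ->
  exists2 W, L W & forall z, nm z <= r -> nm (W z - V z) <= e.
Proof.
move=> L_lie L_shear L_mixed [hV [H hVH]] r0 e0.
have /hamiltonian_functionP [hH _] := hVH.
have c0 : 0 < #|{: I}|%:R + 1 :> R by rewrite ltr_wpDl.
pose e' := e / (#|{: I}|%:R + 1).
have e'0 : 0 < e' by rewrite divr_gt0.
(* Radius [r + 1] leaves a unit ball around each point of the ball of radius [r], so the Cauchy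
   estimate bounds the derivatives of [P - H] by the same [e']. Hamilton's equations carry this over
   to the components of the fields. *)
have [P [pP hP]] := polynomial_dense cs hH (ltr_wpDl (ltW r0) ltr01) e'0.
have hPh := polynomial_holomorphic pP.
have [W LW hWP] := generated_polynomial L_lie L_shear L_mixed pP.
exists W => // z hz.
have -> : e = (#|{: I}|%:R + 1) * e' by rewrite /e' mulrC divfK// gt_eqF.
apply: (@le_trans _ _ (#|{: I}|%:R * e')); last by rewrite ler_wpM2r ?(ltW e'0)// lerDl.
apply: nm_le_sum_coordinates => i.
have -> : zc i (W z - V z) = (if i.1 then 1 else -1) *
    dirder (fun z => P z - H z) z (ddz (conj_index i)).
  rewrite coordinateB (hamiltonian_component _ _ hWP) (hamiltonian_component _ _ hVH).
  by rewrite (dirderB z _ hPh hH) mulrBr.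
have -> : nm ((if i.1 then 1 else -1) * dirder (fun z => P z - H z) z (ddz (conj_index i)) : C) =
    nm (dirder (fun z => P z - H z) z (ddz (conj_index i)) : C).
  by rewrite nmM; case: i.1; rewrite ?nmN nm1 mul1r.
have hb w : nm (w - z) <= 1 -> nm (P w - H w) <= e'.
  move=> hw; apply: hP => j; rewrite (le_trans (nm_coordinate_le _ _ _))//.
  have -> : w = z + (w - z) by rewrite addrC subrK.
  by rewrite (le_trans (nmD _ _))// lerD.
rewrite (le_trans (dirder_le _ (holomorphicB hPh hH) ltr01 hb))// divr1.
by rewrite ler_piMr ?(ltW e'0) ?nm_coord_dir_le.
Qed.

(** [G] is left general so as to cover both the explicit generators and the set of all complete
    Hamiltonian fields. *)
Lemma dense_lie_generated (G : set (X -> X)) : G `<=` hamiltonian_fields form ->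
  (forall i p, G (fun z => zc i z ^+ p *: ddz (conj_index i))) ->
  (forall j k : 'I_n, j != k ->
    G (fun z => zc (true, j) z *: ddz (false, k) + zc (true, k) z *: ddz (false, j))) ->
  dense_in (lie_generated G) (hamiltonian_fields form).
Proof.
move=> G_ham G_shear G_mixed; split.
  by apply: smallest_sub => //; exact: hamiltonian_lie_subalgebra.
move=> V hV; apply: closure_of_approx => r e r0 e0.
have sub : G `<=` lie_generated G by exact: sub_gen_smallest.
apply: hamiltonian_field_approx => //; first exact: lie_generated_subalgebra.
- by move=> i p; apply: sub; exact: G_shear.
- by move=> j k jk; apply: sub; exact: G_mixed.
Qed.

Lemma complete_shear i p : complete_field (fun z => zc i z ^+ p *: ddz (conj_index i)).
Proof.
apply: complete_of_constant_along => z t.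
have -> : zc i (z + t *: (zc i z ^+ p *: ddz (conj_index i))) = zc i z; last by [].
rewrite coordinateD !coordinateZ coordinate_dir (_ : i == conj_index i = false) ?mulr0 ?addr0//.
by case: i => [[] k]; rewrite xpair_eqE.
Qed.

Lemma complete_mixed s (j k : 'I_n) : complete_field
  (fun z => zc (s, j) z *: ddz (~~ s, k) + zc (s, k) z *: ddz (~~ s, j)).
Proof.
apply: complete_of_constant_along => z t.
have h l : zc (s, l) (z + t *: (zc (s, j) z *: ddz (~~ s, k) + zc (s, k) z *: ddz (~~ s, j)))
    = zc (s, l) z.
  rewrite coordinateD coordinateZ coordinateD !coordinateZ !coordinate_dir !xpair_eqE.
  by rewrite (_ : s == ~~ s = false) /= ?mulr0 ?addr0 ?mulr0 ?addr0//; case: s.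
by rewrite !h.
Qed.

End Density.

(** * The cotangent space and its explicit generators *)

Section CotangentCoordinates.
Context {R : realType} {n : nat}.
Local Notation C := (Cplx R).
Local Notation X := (cotangent R n).
Local Notation I := (bool * 'I_n)%type.

Definition cotangent_coord (i : I) (z : X) : C := if i.1 then xc i.2 z else yc i.2 z.

Definition cotangent_dir (i : I) : X := if i.1 then ddx R i.2 else ddy R i.2.

(** The norm is the maximum of the coordinate norms. This is read off from the balls, which are
    componentwise both for products and for matrices; hence the strict inequality and the positive
    radius. *)
Lemma cotangent_nm_ltP (z : X) (r : R) : 0 < r ->
  nm z < r <-> forall i, nm (cotangent_coord i z) < r.
Proof.
move=> r0; rewrite -nm_lt.
have hb : `|z| < rc r <-> ball (0 : X) (rc r) z.
  by rewrite -ball_normE /= sub0r normrN.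
have hC (c : C) : nm c < r <-> ball (0 : C) (rc r) c.
  by rewrite -ball_normE /= sub0r normrN nm_lt.
split.
  move=> /hb [[_ h1] [_ h2]] [b k]; apply/hC; case: b => /=.
    by have := h1 ord0 k; rewrite mxE.
  by have := h2 ord0 k; rewrite mxE.
have rr0 := rc_gt0 r0.
move=> h; apply/hb; split; split=> // a k; rewrite (ord1 a) mxE; apply/hC.
  exact: (h (true, k)).
exact: (h (false, k)).
Qed.

Lemma nm_cotangent_coord_le i (z : X) : nm (cotangent_coord i z) <= nm z.
Proof.
apply/ler_addgt0Pr => e e0; apply/ltW.
by apply: (cotangent_nm_ltP _ _).1; rewrite ?ltrDl// ltr_wpDl ?nm_ge0.
Qed.

Lemma cotangent_nm_leP (z : X) (r : R) : 0 <= r ->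
  nm z <= r <-> forall i, nm (cotangent_coord i z) <= r.
Proof.
move=> r0; split=> [h i|h]; first by rewrite (le_trans (nm_cotangent_coord_le _ _)).
apply/ler_addgt0Pr => e e0; apply/ltW/cotangent_nm_ltP; first by rewrite ltr_wpDl.
by move=> i; rewrite (le_lt_trans (h i))// ltrDl.
Qed.

Lemma cotangent_coordD i (z w : X) : cotangent_coord i (z + w) = cotangent_coord i z + cotangent_coord i w.
Proof. by rewrite /cotangent_coord /xc /yc; case: i.1; rewrite mxE. Qed.

Lemma cotangent_coordZ i a (z : X) : cotangent_coord i (a *: z) = a * cotangent_coord i z.
Proof. by rewrite /cotangent_coord /xc /yc; case: i.1; rewrite mxE. Qed.

Lemma cotangent_coord_dir i j : cotangent_coord i (cotangent_dir j) = (i == j)%:R.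
Proof.
case: i j => [[] k] [[] l]; rewrite /cotangent_coord /cotangent_dir /xc /yc /ddx /ddy /= mxE ?eqxx //=.
Qed.

Lemma cotangent_coord_inj (z w : X) : (forall i, cotangent_coord i z = cotangent_coord i w) -> z = w.
Proof.
case: z w => [z1 z2] [w1 w2] h; congr pair; apply/rowP => k.
  exact: (h (true, k)).
exact: (h (false, k)).
Qed.

Lemma nm_cotangent_dir_le i : nm (cotangent_dir i) <= 1.
Proof. by apply/cotangent_nm_leP => // j; rewrite cotangent_coord_dir nm_nat; case: eqP. Qed.

Lemma compact_cotangent_polydisc r : exists2 K : set X, compact K & [set z | forall i, nm (cotangent_coord i z) <= r] `<=` K.
Proof.
pose S := [set z : C | `|complex.Re z| <= r /\ `|complex.Im z| <= r].
pose K := [set v : 'rV[C]_n | forall k, S (v ord0 k)].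
have cK : compact K.
  by apply: (rV_compact (A := fun=> S)) => k; exact: compact_square.
exists (K `*` K); first exact: compact_setX.
move=> z hz; split=> k; apply: disc_sub_square.
  exact: (hz (true, k)).
exact: (hz (false, k)).
Qed.


Definition cotangent_coordinates : coordinates (cotangent R n) I :=
  Coordinates cotangent_coordD cotangent_coordZ cotangent_coord_dir
    cotangent_coord_inj nm_cotangent_coord_le nm_cotangent_dir_le
    compact_cotangent_polydisc.

Local Notation w := (canonical_symplectic_form R n).

Lemma hamiltonian_shear_y k p : hamiltonian_function w (shear_y k p)
  (fun z => - (p.+1%:R)^-1 * xc k z ^+ p.+1).
Proof. exact: (hamiltonian_shear cotangent_coordinates (true, k) p). Qed.

Lemma hamiltonian_shear_x k q : hamiltonian_function w (shear_x k q)
  (fun z => (q.+1%:R)^-1 * yc k z ^+ q.+1).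
Proof. exact: (hamiltonian_shear cotangent_coordinates (false, k) q). Qed.

Lemma hamiltonian_mixed_y j k : hamiltonian_function w (mixed_y j k)
  (fun z => - (xc j z * xc k z)).
Proof.
have -> : (fun z => - (xc j z * xc k z)) = (fun z : X => -1 * (xc j z * xc k z)).
  by apply/funext => z; rewrite mulN1r.
exact: (hamiltonian_mixed cotangent_coordinates true j k).
Qed.

Lemma hamiltonian_mixed_x j k : hamiltonian_function w (mixed_x j k)
  (fun z => yc j z * yc k z).
Proof.
have -> : (fun z => yc j z * yc k z) = (fun z : X => 1 * (yc j z * yc k z)).
  by apply/funext => z; rewrite mul1r.
exact: (hamiltonian_mixed cotangent_coordinates false j k).
Qed.

Lemma generators_complete : generators R n `<=` complete_field.
Proof.
move=> V [[k [p ->]]|[k [q ->]]|[j [k [_ ->]]]|[j [k [_ ->]]]].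
- exact: (complete_shear cotangent_coordinates (true, k) p).
- exact: (complete_shear cotangent_coordinates (false, k) q).
- exact: (complete_mixed cotangent_coordinates true j k).
- exact: (complete_mixed cotangent_coordinates false j k).
Qed.

Lemma generators_hamiltonian : generators R n `<=` hamiltonian_fields w.
Proof.
have ham V H : hamiltonian_function w V H -> hamiltonian_fields w V.
  move=> h; split; last by exists H.
  exact: (hamiltonian_function_holomorphic (cs := cotangent_coordinates) h).
move=> V [[k [p ->]]|[k [q ->]]|[j [k [_ ->]]]|[j [k [_ ->]]]].
- exact: ham (hamiltonian_shear_y k p).
- exact: ham (hamiltonian_shear_x k q).
- exact: ham (hamiltonian_mixed_y j k).
- exact: ham (hamiltonian_mixed_x j k).
Qed.

Lemma dense_of_generators (G : set (X -> X)) : generators R n `<=` G ->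
  G `<=` hamiltonian_fields w -> dense_in (lie_generated G) (hamiltonian_fields w).
Proof.
move=> genG Gham; apply: (dense_lie_generated (cs := cotangent_coordinates)) => //.
- move=> [[] k] p; apply: genG; first by apply: Or41; exists k, p.
  by apply: Or42; exists k, p.
- by move=> j k jk; apply: genG; apply: Or43; exists j, k.
Qed.

End CotangentCoordinates.

Theorem theorem13 (R : realType) (n : nat) (hn : (1 <= n)%N) :
  hamiltonian_density_property (canonical_symplectic_form R n) /\
  symplectic_density_property (canonical_symplectic_form R n) /\
  hamiltonian_fields (canonical_symplectic_form R n) =
    symplectic_fields (canonical_symplectic_form R n) /\
  dense_in (lie_generated (generators R n))
    (hamiltonian_fields (canonical_symplectic_form R n)) /\
  generators R n `<=` complete_field /\
  (forall (k : 'I_n) (p : nat),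
    hamiltonian_function (canonical_symplectic_form R n) (shear_y k p)
      (fun z => - (p.+1%:R)^-1 * xc k z ^+ p.+1)) /\
  (forall (k : 'I_n) (q : nat),
    hamiltonian_function (canonical_symplectic_form R n) (shear_x k q)
      (fun z => (q.+1%:R)^-1 * yc k z ^+ q.+1)) /\
  (forall j k : 'I_n, j != k ->
    hamiltonian_function (canonical_symplectic_form R n) (mixed_y j k)
      (fun z => - (xc j z * xc k z))) /\
  (forall j k : 'I_n, j != k ->
    hamiltonian_function (canonical_symplectic_form R n) (mixed_x j k)
      (fun z => yc j z * yc k z)).
Proof.
have ham_symp : hamiltonian_fields (canonical_symplectic_form R n) =
    symplectic_fields (canonical_symplectic_form R n).
  exact: (hamiltonian_eq_symplectic cotangent_coordinates).
have gen_cplt := @generators_complete R n.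
have gen_ham := @generators_hamiltonian R n.
(* Density for all complete Hamiltonian fields follows from the lemma on sets containing the
   generators; equality of the two classes of fields then gives the symplectic case. *)
have ham_dense : hamiltonian_density_property (canonical_symplectic_form R n).
  by apply: dense_of_generators => V; [move=> hV; split; [exact: gen_ham|exact: gen_cplt]|case].
split=> //; split.
  by rewrite /symplectic_density_property -ham_symp.
split=> //; split; first exact: dense_of_generators.
split=> //; split; first exact: hamiltonian_shear_y.
split; first exact: hamiltonian_shear_x.
by split=> j k _; [exact: hamiltonian_mixed_y|exact: hamiltonian_mixed_x].
Qed.
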